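(* Let $(G,<)$ be a noncommutative ordered group, let $K$ be a skew field, and let $K[G]$ be the group ring. Then $K(G)$ contains a noncommutative free group algebra over its center $Z$. That is, there is a free group $H$ of rank at least $2$ contained in the multiplicative group $K(G)\setminus\{0\}$ such that the $Z$-subalgebra of $K(G)$ generated by $H$ is (via the natural map) isomorphic to the group algebra $Z[H]$.
   Context: An ordered group $(G,<)$ is a group $G$ with a total order $<$ such that $x<y$ implies $zx<zy$ and $xz<yz$ for all $x,y,z\in G$. A skew field is a nonzero associative ring with $1$ in which every nonzero element is invertible. For a skew field $K$ and an ordered group $(G,<)$, the Malcev–Neumann series ring $K((G;<))$ is the set of formal series $f=\sum_{x\in G}x a_x$ ($a_x\in K$) whose support $\mathrm{supp}(f)=\{x: a_x\neq 0\}$ is well-ordered, with componentwise addition and multiplication induced by the operations of $K$ and $G$ and the rule $ax=xa$ for $a\in K$, $x\in G$; it is a skew field containing the group ring $K[G]$. $K(G)$ denotes the skew subfield of $K((G;<))$ generated by $K[G]$. *)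

(* Defs.v *)
From HB Require Import structures.
From mathcomp Require Import all_boot all_order all_algebra.
From Stdlib Require Import ClassicalEpsilon.
Set Implicit Arguments. Unset Strict Implicit. Unset Printing Implicit Defensive.
Import GRing.Theory.
Local Open Scope ring_scope.

Record ordgroup := OrdGroup {
  og_car :> Type;
  og_mul : og_car -> og_car -> og_car;
  og_one : og_car;
  og_inv : og_car -> og_car;
  og_lt  : og_car -> og_car -> Prop;
  og_mulA : forall x y z, og_mul x (og_mul y z) = og_mul (og_mul x y) z;
  og_mul1g : forall x, og_mul og_one x = x;
  og_mulg1 : forall x, og_mul x og_one = x;
  og_mulVg : forall x, og_mul (og_inv x) x = og_one;
  og_mulgV : forall x, og_mul x (og_inv x) = og_one;
  og_lt_irr : forall x, ~ og_lt x x;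
  og_lt_trans : forall x y z, og_lt x y -> og_lt y z -> og_lt x z;
  og_lt_total : forall x y, x <> y -> og_lt x y \/ og_lt y x;
  og_lt_mull : forall x y z, og_lt x y -> og_lt (og_mul z x) (og_mul z y);
  og_lt_mulr : forall x y z, og_lt x y -> og_lt (og_mul x z) (og_mul y z)
}.

(* Formal series over G with coefficients in K are represented by their
   coefficient functions G -> K. *)

Definition supp (G : ordgroup) (K : unitRingType) (f : G -> K) (x : G) : Prop :=
  f x != 0.

Definition is_series (G : ordgroup) (K : unitRingType) (f : G -> K) : Prop :=
  forall P : G -> Prop, (forall x, P x -> supp f x) -> (exists x, P x) ->
    exists m, P m /\ forall y, P y -> ~ og_lt y m.

Definition in_group_ring (G : ordgroup) (K : unitRingType) (f : G -> K) : Prop :=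
  exists s : seq G, forall x, f x != 0 -> List.In x s.

Definition feq (G : ordgroup) (K : unitRingType) (f g : G -> K) : Prop :=
  forall x, f x = g x.

Definition mn_zero (G : ordgroup) (K : unitRingType) : G -> K := fun _ => 0.

Definition mn_one (G : ordgroup) (K : unitRingType) : G -> K :=
  fun x => if excluded_middle_informative (x = og_one G) then 1 else 0.

Definition mn_add (G : ordgroup) (K : unitRingType) (f g : G -> K) : G -> K :=
  fun x => f x + g x.

Definition mn_opp (G : ordgroup) (K : unitRingType) (f : G -> K) : G -> K :=
  fun x => - f x.

Definition conv_supp (G : ordgroup) (K : unitRingType) (f g : G -> K) (x y : G)
  : Prop := f y != 0 /\ g (og_mul (og_inv y) x) != 0.

(* product of series: (f g)_x = sum_{y z = x} f_y g_z  (a finite sum when f, g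
   have well-ordered supports; the chosen duplicate-free enumeration of the
   finitely many contributing y is irrelevant) *)
Definition mn_mul (G : ordgroup) (K : unitRingType) (f g : G -> K) : G -> K :=
  fun x =>
    let s := epsilon (inhabits [::])
               (fun s : seq G => List.NoDup s /\
                  forall y, conv_supp f g x y <-> List.In y s) in
    \sum_(y <- s) f y * g (og_mul (og_inv y) x).

(* K(G): the skew subfield of K((G;<)) generated by K[G], i.e. the smallest
   subset of K((G;<)) containing K[G] and closed under +, -, *, and inverses of
   nonzero elements (and stable under coefficientwise equality). *)
Inductive in_KG (G : ordgroup) (K : unitRingType) : (G -> K) -> Prop :=
| KG_ring f : in_group_ring f -> in_KG f
| KG_add f g : in_KG f -> in_KG g -> in_KG (mn_add f g)
| KG_opp f : in_KG f -> in_KG (mn_opp f)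
| KG_mul f g : in_KG f -> in_KG g -> in_KG (mn_mul f g)
| KG_inv f g : in_KG f -> ~ feq f (@mn_zero G K) -> is_series g ->
    feq (mn_mul f g) (@mn_one G K) -> feq (mn_mul g f) (@mn_one G K) -> in_KG g
| KG_eq f g : in_KG f -> feq f g -> in_KG g.

Definition in_center (G : ordgroup) (K : unitRingType) (z : G -> K) : Prop :=
  in_KG z /\ forall f, in_KG f -> feq (mn_mul z f) (mn_mul f z).

(* words in generators indexed by I; (i, true) stands for the inverse letter *)
Definition word (I : Type) := seq (I * bool).

Fixpoint reduced (I : Type) (w : word I) : Prop :=
  match w with
  | a :: ((b :: _) as w') => ~ (a.1 = b.1 /\ a.2 <> b.2) /\ reduced w'
  | _ => True
  end.

Definition eval_word (G : ordgroup) (K : unitRingType) (I : Type)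
  (x xi : I -> G -> K) (w : word I) : G -> K :=
  foldr (fun l acc => mn_mul (if l.2 then xi l.1 else x l.1) acc)
        (@mn_one G K) w.

Definition free_gens (G : ordgroup) (K : unitRingType) (I : Type)
  (x xi : I -> G -> K) : Prop :=
  forall w : word I, reduced w -> w <> [::] ->
    ~ feq (eval_word x xi w) (@mn_one G K).

Fixpoint mn_sum (G : ordgroup) (K : unitRingType) (n : nat) (F : nat -> G -> K)
  : G -> K :=
  match n with
  | 0 => @mn_zero G K
  | n'.+1 => mn_add (mn_sum n' F) (F n')
  end.

(* The natural map Z[H] -> K(G) is injective: pairwise distinct elements of H
   are left linearly independent over the center Z of K(G). *)
Definition center_lin_indep (G : ordgroup) (K : unitRingType) (I : Type)
  (x xi : I -> G -> K) : Prop :=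
  forall (n : nat) (z : nat -> G -> K) (w : nat -> word I),
    (forall k, (k < n)%N -> in_center (z k)) ->
    (forall k l, (k < n)%N -> (l < n)%N -> k <> l ->
        ~ feq (eval_word x xi (w k)) (eval_word x xi (w l))) ->
    feq (mn_sum n (fun k => mn_mul (z k) (eval_word x xi (w k)))) (@mn_zero G K) ->
    forall k, (k < n)%N -> feq (z k) (@mn_zero G K).

(* Main.v *)
(* Let D be the skew field of Malcev-Neumann series. For four elements t_l of G,
   indexed by the letters l of a free group of rank 2, the elements
   (1 - t_{l^-1}) (1 - t_l)^-1 of K(G) are pairwise inverse, and the claim is that for a
   suitable choice the reduced words in them are linearly independent over the
   series supported in the centre of G.

   If y x y^-1 >= x^2 for some x > 1 and some y, then (after replacing y by a power)
   the elements x^d y with d = 0, 1, 3, 4, or their inverses, are > 1 and generate a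
   monoid which is free modulo the centre. Expanding geometric series, each reduced
   word w then involves a monomial which occurs in no other word of length <= |w|.

   Otherwise conjugation preserves the archimedean classes and acts trivially on
   them. For c = [y, x] > 1 the elements infinitely small with respect to c form a
   normal subgroup N, modulo which c is central, so that x and y generate a
   Heisenberg group modulo N. Let t_l = x^d y as above, and let F be the field of
   left fractions of Laurent polynomials in x whose coefficients are series in
   elements commuting with x and y modulo N. The words are shown to be left linearly
   independent over F. Comparing a shortest relation with its multiple by some t_l
   gives b in F with t_l b t_i^-1 - b = 1 - x^{1} or 1 - x^{-1}; such a b has to be a
   Laurent polynomial, which is impossible for degree reasons. *)
From HB Require Import structures.
Require Import Defs.
From mathcomp Require Import all_boot all_order all_algebra.
From mathcomp Require Import boolp classical_sets.
From mathcomp Require Import zify.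
Set Implicit Arguments. Unset Strict Implicit. Unset Printing Implicit Defensive.
Import Order.TTheory GRing.Theory.

(** * Ordered groups *)

HB.instance Definition _ (G : ordgroup) := gen_eqMixin (og_car G).
HB.instance Definition _ (G : ordgroup) := gen_choiceMixin (og_car G).
HB.instance Definition _ (G : ordgroup) :=
  isGroup.Build (og_car G) (@og_mulA G) (@og_mul1g G) (@og_mulg1 G)
    (@og_mulVg G) (@og_mulgV G).

Definition og_ltb (G : ordgroup) (x y : G) : bool := `[< og_lt x y >].

Lemma og_ltb_irr (G : ordgroup) : irreflexive (@og_ltb G).
Proof. by move=> x; apply/asboolP/og_lt_irr. Qed.

Lemma og_ltb_trans (G : ordgroup) : transitive (@og_ltb G).
Proof. by move=> y x z /asboolP xy /asboolP yz; apply/asboolP/(og_lt_trans xy). Qed.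

HB.instance Definition _ (G : ordgroup) :=
  Order.Lt_isPOrder.Build (Order.Disp tt tt) (og_car G)
    (@og_ltb_irr G) (@og_ltb_trans G).

Lemma og_le_total (G : ordgroup) : total (@Order.le _ (og_car G)).
Proof.
move=> x y; rewrite !le_eqVlt; have [<-|/eqP xy] := eqVneq x y; first by [].
by have [lt|lt] := og_lt_total xy; apply/orP; [left|right]; apply/orP; right;
  apply/asboolP.
Qed.

HB.instance Definition _ (G : ordgroup) :=
  Order.POrder_isTotal.Build _ (og_car G) (@og_le_total G).

Section OrderedGroup.
Variable G : ordgroup.
Local Open Scope group_scope.
Local Open Scope order_scope.
Implicit Types (x y z : G).

Lemma og_ltP x y : reflect (og_lt x y) (x < y).
Proof. exact: asboolP. Qed.

Lemma og_ltM2l z x y : (z * x < z * y) = (x < y).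
Proof.
apply/idP/idP => /og_ltP lt; apply/og_ltP; last exact: og_lt_mull.
by rewrite -(mulKg z x) -(mulKg z y); apply: og_lt_mull.
Qed.

Lemma og_ltM2r z x y : (x * z < y * z) = (x < y).
Proof.
apply/idP/idP => /og_ltP lt; apply/og_ltP; last exact: og_lt_mulr.
by rewrite -(mulgK z x) -(mulgK z y); apply: og_lt_mulr.
Qed.

Lemma og_leM2l z x y : (z * x <= z * y) = (x <= y).
Proof. by rewrite !leNgt og_ltM2l. Qed.

Lemma og_leM2r z x y : (x * z <= y * z) = (x <= y).
Proof. by rewrite !leNgt og_ltM2r. Qed.

Lemma og_leM x y z t : x <= y -> z <= t -> x * z <= y * t.
Proof. by move=> xy zt; rewrite (@le_trans _ _ (y * z)) ?og_leM2l ?og_leM2r. Qed.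

Lemma og_ltV x y : (x^-1 < y^-1) = (y < x).
Proof. by rewrite -(og_ltM2l x) mulgV -(og_ltM2r y) mul1g mulgVK. Qed.

Lemma og_leV x y : (x^-1 <= y^-1) = (y <= x).
Proof. by rewrite !leNgt og_ltV. Qed.

Lemma og_ltV1 x : (x^-1 < (1 : G)) = ((1 : G) < x).
Proof. by rewrite -(og_ltV x 1) invg1. Qed.

Lemma og_lt1V x : ((1 : G) < x^-1) = (x < (1 : G)).
Proof. by rewrite -(og_ltV 1 x) invg1. Qed.

Lemma og_leX x y n : x <= y -> x ^+ n <= y ^+ n.
Proof. by move=> xy; elim: n => [|n IH]; rewrite ?expg0 // !expgS og_leM. Qed.

Lemma og_le1X x n : (1 : G) <= x -> (1 : G) <= x ^+ n.
Proof. by move=> /(og_leX n); rewrite expg1n. Qed.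

Lemma og_leX1 x n : x <= (1 : G) -> x ^+ n <= (1 : G).
Proof. by move=> /(og_leX n); rewrite expg1n. Qed.

Lemma og_ltX2l x m n : (1 : G) < x -> (m < n)%N -> x ^+ m < x ^+ n.
Proof.
move=> x1 /subnKC <-; rewrite addSn -addnS expgnDr -[ltLHS]mulg1 og_ltM2l expgS.
by apply: (lt_le_trans x1); rewrite -[leLHS]mulg1 og_leM2l og_le1X // ltW.
Qed.

Lemma og_leX2l x m n : (1 : G) <= x -> (m <= n)%N -> x ^+ m <= x ^+ n.
Proof. by move=> x1 /subnKC <-; rewrite expgnDr -[leLHS]mulg1 og_leM2l og_le1X. Qed.

Lemma og_ltJ z x y : (x ^ z < y ^ z) = (x < y).
Proof. by rewrite !conjgE og_ltM2l og_ltM2r. Qed.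

Lemma og_leJ z x y : (x ^ z <= y ^ z) = (x <= y).
Proof. by rewrite !leNgt og_ltJ. Qed.

End OrderedGroup.

(** * Well-ordered subsets of an ordered group *)

Section WellOrderedSubsets.
Variable G : ordgroup.
Local Open Scope group_scope.
Local Open Scope order_scope.
Implicit Types (A B P : G -> Prop) (x y z : G).

(** Shaped so that [is_series f] is convertible to [wo (supp f)]; the lemmas below then apply
    directly to supports. *)
Definition wo A := forall P, (forall x, P x -> A x) -> (exists x, P x) ->
  exists m, P m /\ forall y, P y -> ~ og_lt y m.

Lemma wo_min A P : wo A -> (forall x, P x -> A x) -> (exists x, P x) ->
  exists m, P m /\ forall y, P y -> m <= y.
Proof.
move=> woA PA exP; have [m [Pm mP]] := woA P PA exP.
by exists m; split=> // y /mP ym; rewrite leNgt; apply/og_ltP.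
Qed.

Lemma woP A : (forall P, (forall x, P x -> A x) -> (exists x, P x) ->
  exists m, P m /\ forall y, P y -> m <= y) -> wo A.
Proof.
move=> H P PA exP; have [m [Pm mP]] := H P PA exP.
by exists m; split=> // y /mP; rewrite leNgt => /og_ltP.
Qed.

Lemma wo_sub A B : (forall x, A x -> B x) -> wo B -> wo A.
Proof. by move=> AB woB P PA; apply: woB => x /PA/AB. Qed.

Lemma wo_union A B : wo A -> wo B -> wo (fun x => A x \/ B x).
Proof.
move=> woA woB; apply: woP => P PAB exP.
have [exA|nA] := pselect (exists x, P x /\ A x); last first.
  apply: (wo_min woB) exP => x Px; have [Ax|//] := PAB x Px.
  by case: nA; exists x.
have [exB|nB] := pselect (exists x, P x /\ B x); last first.
  apply: (wo_min woA) exP => x Px; have [//|Bx] := PAB x Px.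
  by case: nB; exists x.
have [a [[Pa Aa] aP]] := wo_min woA (fun x (H : P x /\ A x) => H.2) exA.
have [b [[Pb Bb] bP]] := wo_min woB (fun x (H : P x /\ B x) => H.2) exB.
have [ab|ba] := leP a b.
  exists a; split=> // y Py; have [Ay|By] := PAB y Py; first exact: aP.
  by apply: le_trans ab _; apply: bP.
exists b; split=> // y Py; have [Ay|By] := PAB y Py; last exact: bP.
by apply: le_trans (ltW ba) _; apply: aP.
Qed.

Definition finite_pred A := exists s : seq G, forall x, A x -> x \in s.

Lemma wo_finite A : finite_pred A -> wo A.
Proof.
move=> [s As]; apply: (@wo_sub _ (fun x => x \in s)) => // {A As}.
elim: s => [|a s IH]; first by move=> P P0 [x /P0].
apply: (@wo_sub _ (fun x => x = a \/ x \in s)).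
  by move=> x; rewrite inE => /orP[/eqP|]; [left|right].
apply: wo_union IH; apply: woP => P Pa [x Px]; exists x; split=> // y Py.
by rewrite (Pa _ Px) (Pa _ Py).
Qed.

Lemma wo_mul A B : wo A -> wo B -> wo (fun x => exists a b, [/\ A a, B b & x = a * b]).
Proof.
move=> woA woB; apply: woP => P PAB exP; apply: contrapT => nomin.
have dec p : P p -> exists2 q, P q & q < p.
  move=> Pp; apply: contrapT => nq; apply: nomin; exists p; split=> // y Py.
  by rewrite leNgt; apply/negP => yp; apply: nq; exists y.
(* [rec p a b] says that [p = a b] where [a] is minimal among all left factors of
   elements of [P] below [p]. If [b] is the least right factor of such a [p], then
   a smaller [p'] with [rec p' a' b'] has [a <= a'] and [b <= b']: contradiction. *)
pose rec p a b := [/\ P p, A a, B b & p = a * b /\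
  forall q a' b', P q -> q <= p -> A a' -> B b' -> q = a' * b' -> a <= a'].
have exrec p : P p -> exists q a b, q <= p /\ rec q a b.
  move=> Pp.
  pose L a := exists q b, [/\ P q, q <= p, A a, B b & q = a * b].
  have [||a [[q [b [Pq qp Aa Bb qE]]] aL]] := @wo_min A L woA.
  - by move=> a [q [b []]].
  - by have [a [b [Aa Bb pE]]] := PAB p Pp; exists a, p, b.
  exists q, a, b; split=> //; split=> //; split=> // r a' b' Pr rq Aa' Bb' rE.
  by apply: aL; exists r, b'; split=> //; apply: le_trans qp.
pose R b := exists p a, rec p a b.
have [||b [[p [a [Pp Aa Bb [pE pmin]]]] bR]] := @wo_min B R woB.
- by move=> b [p [a []]].
- by have [p0 Pp0] := exP; have [q [a [b [_ r]]]] := exrec p0 Pp0; exists b, q, a.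
have [q Pq qp] := dec p Pp.
have [r [a' [b' [rq rec']]]] := exrec q Pq.
have bb' : b <= b' by apply: bR; exists r, a'.
have [Pr Aa' Bb' [rE _]] := rec'.
have aa' : a <= a' by apply: (pmin r a' b') => //; apply: le_trans rq (ltW qp).
have : p <= r by rewrite pE rE og_leM.
by rewrite leNgt (le_lt_trans rq qp).
Qed.

(** Take the greatest [u] in [A] with only finitely many elements of [A] up to [u]. If [A] went on
    beyond [u], the least element above [u] would have the same property. *)
Lemma wo_cowo_finite A : wo A -> (forall P, (forall x, P x -> A x) ->
  (exists x, P x) -> exists m, P m /\ forall y, P y -> y <= m) -> finite_pred A.
Proof.
move=> woA cowoA.
have [exA|nA] := pselect (exists x, A x); last first.
  by exists [::] => x Ax; case: nA; exists x.
pose Q u := A u /\ finite_pred (fun x => A x /\ x <= u).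
have [||u [[Au [s sP]] umax]] := cowoA Q.
- by move=> u [].
- have [m [Am mA]] := wo_min woA (fun x Ax => Ax) exA.
  exists m; split=> //; exists [:: m] => x [Ax xm]; rewrite inE eq_le xm.
  exact: mA.
exists s => x Ax; apply: (sP); split=> //; rewrite leNgt; apply/negP => ux.
have [||v [[Av uv] vmin]] := @wo_min A (fun y => A y /\ u < y) woA.
- by move=> y [].
- by exists x.
suff: Q v by move=> /umax; rewrite leNgt uv.
split=> //; exists (v :: s) => y [Ay yv]; rewrite inE.
have [yu|uy] := leP y u; first by rewrite sP ?orbT.
by rewrite eq_le yv vmin.
Qed.

(** Sending [a] to [a^-1 * x] reverses the order, so a nonempty part of the fiber has a least
    element because [A] is well-ordered and a greatest one because [B] is. *)
Lemma wo_fiber A B x : wo A -> wo B -> finite_pred (fun a => A a /\ B (a^-1 * x)).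
Proof.
move=> woA woB; apply: wo_cowo_finite; first by apply: wo_sub woA => a [].
move=> P PAB [a Pa].
have [||b [[c Pc bE] bmin]] := @wo_min B (fun b => exists2 c, P c & b = c^-1 * x) woB.
- by move=> b [c /PAB[_ Bc] ->].
- by exists (a^-1 * x), a.
exists c; split=> // y Py; move: (bmin (y^-1 * x)); rewrite bE og_leM2r og_leV.
by apply; exists y.
Qed.

End WellOrderedSubsets.

(** * Products of series as coefficient functions *)

Section Product.
Variables (G : ordgroup) (K : unitRingType).
Local Open Scope ring_scope.
Implicit Types (f g h : G -> K) (x y z : G).

Lemma In_mem (T : eqType) (x : T) s : List.In x s <-> x \in s.
Proof.
elim: s => [|a s IH] /=; first by split.
rewrite inE; split=> [[->|/IH ->]|/orP[/eqP ->|/IH]]; rewrite ?eqxx ?orbT //; by [left|right].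
Qed.

Lemma NoDup_uniq (T : eqType) (s : seq T) : List.NoDup s <-> uniq s.
Proof.
elim: s => [|a s IH] /=; first by split=> // _; constructor.
split=> [H|/andP[/negP as_ us]].
  by inversion_clear H as [|? ? Ha Hs]; apply/andP; split; [apply/negP => /In_mem|apply/IH].
by constructor; [move/In_mem|apply/IH].
Qed.

Lemma mn_mulE f g x (s : seq G) : uniq s ->
  (forall y, f y != 0 -> g (y^-1 * x)%g != 0 -> y \in s) ->
  mn_mul f g x = \sum_(y <- s) f y * g (y^-1 * x)%g.
Proof.
move=> us sP; rewrite /mn_mul.
set Q := fun s : seq G => List.NoDup s /\ forall y, conv_supp f g x y <-> List.In y s.
set e := ClassicalEpsilon.epsilon _ _.
pose p y := (f y != 0) && (g (y^-1 * x)%g != 0).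
have : Q e.
  apply: ClassicalEpsilon.epsilon_spec; exists (filter p s); split.
    by apply/NoDup_uniq/filter_uniq.
  move=> y; rewrite In_mem mem_filter; split=> [[fy gy]|/andP[/andP[fy gy] _]]; last by split.
  by rewrite /p fy gy sP.
case=> /NoDup_uniq ue eP.
rewrite [RHS](bigID p) /= [X in _ = _ + X]big1 ?addr0 //; last first.
  move=> y; rewrite /p negb_and !negbK => /orP[]/eqP ->; by rewrite ?mul0r ?mulr0.
rewrite -(big_filter s p); apply/perm_big/uniq_perm; rewrite ?filter_uniq //.
move=> y; rewrite mem_filter; apply/idP/idP => [/In_mem/eP[fy gy]|/andP[/andP[fy gy] _]].
  by rewrite /p fy gy sP.
by apply/In_mem/eP.
Qed.

Lemma supp_fiber f g x : is_series f -> is_series g -> exists2 s : seq G, uniq s &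
  forall y, f y != 0 -> g (y^-1 * x)%g != 0 -> y \in s.
Proof.
move=> sf sg; have [s sP] := wo_fiber x sf sg.
by exists (undup s) => [|y fy gy]; rewrite ?undup_uniq // mem_undup sP.
Qed.

Lemma supp_mul f g x : is_series f -> is_series g -> mn_mul f g x != 0 ->
  exists a b, [/\ supp f a, supp g b & x = (a * b)%g].
Proof.
move=> sf sg; have [s us sP] := supp_fiber x sf sg; rewrite (mn_mulE us sP) => n0.
apply: contrapT => H; move/eqP: n0; apply; apply: big1 => y _.
apply/eqP; apply: contrapT => /negP n0; apply: H; exists y, (y^-1 * x)%g.
split; rewrite ?mulVKg //; apply: contra_neq n0; rewrite /supp => ->; by rewrite ?mul0r ?mulr0.
Qed.

Lemma is_series_mul f g : is_series f -> is_series g -> is_series (mn_mul f g).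
Proof.
move=> sf sg; apply: (wo_sub _ (wo_mul sf sg)) => x n0; exact: supp_mul.
Qed.

Lemma is_series_add f g : is_series f -> is_series g -> is_series (mn_add f g).
Proof.
move=> sf sg; apply: (wo_sub _ (wo_union sf sg)) => x.
rewrite /supp /mn_add => n0; have [f0|] := eqVneq (f x) 0; last by left.
by right; move: n0; rewrite f0 add0r.
Qed.

Lemma is_series_opp f : is_series f -> is_series (mn_opp f).
Proof. by apply: wo_sub => x; rewrite /supp /mn_opp oppr_eq0. Qed.

Lemma is_series_finite f : in_group_ring f -> is_series f.
Proof. by move=> [s sP]; apply: wo_finite; exists s => x /sP/In_mem. Qed.

Lemma is_series_zero : is_series (@mn_zero G K).
Proof. by apply: wo_finite; exists [::] => x; rewrite /supp eqxx. Qed.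

Lemma mn_oneE x : mn_one K x = if x == 1%g then 1 else 0.
Proof.
by rewrite /mn_one; case: ClassicalEpsilon.excluded_middle_informative => H;
  case: eqP.
Qed.

Lemma is_series_one : is_series (@mn_one G K).
Proof.
apply: wo_finite; exists [:: 1%g] => x; rewrite /supp mn_oneE inE.
by case: (x == 1%g) => //; rewrite eqxx.
Qed.

Lemma mn_mulA f g h : is_series f -> is_series g -> is_series h ->
  mn_mul f (mn_mul g h) = mn_mul (mn_mul f g) h.
Proof.
move=> sf sg sh; apply: funext => x.
have [A0 AP0] := wo_fiber x sf (is_series_mul sg sh).
have [A1 AP1] := wo_fiber x sf (wo_mul sg sh).
have [Y0 YP0] := wo_fiber x (wo_mul sf sg) sh.
(* Both sides become one double sum: [A] lists the possible first factors, [Y] the possible products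
   of the first two factors. *)
pose A := undup (A0 ++ A1); pose Y := undup Y0.
have uA : uniq A by apply: undup_uniq.
have uY : uniq Y by apply: undup_uniq.
rewrite (mn_mulE uA); last first.
  by move=> y fy ghy; rewrite mem_undup mem_cat AP0.
rewrite (mn_mulE uY); last first.
  by move=> y fgy hy; rewrite mem_undup YP0 //; split=> //; apply: supp_mul.
transitivity (\sum_(z <- A) \sum_(y <- Y) f z * g (z^-1 * y)%g * h (y^-1 * x)%g).
  apply: eq_bigr => z _; have [->|fz] := eqVneq (f z) 0.
    by rewrite mul0r big1 // => y _; rewrite !mul0r.
  rewrite (@mn_mulE _ _ _ (map (fun y => z^-1 * y)%g Y)).
  - rewrite big_map mulr_sumr; apply: eq_bigr => y _.
    by rewrite invgM invgK -!mulgA mulVKg mulrA.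
  - by rewrite map_inj_uniq // => a b /mulgI.
  move=> u gu hu; apply/mapP; exists (z * u)%g; rewrite ?mulKg // mem_undup.
  by apply: YP0; split; [exists z, u|rewrite invgM -mulgA].
rewrite exchange_big /=; apply: eq_bigr => y _.
have [->|hy] := eqVneq (h (y^-1 * x)%g) 0.
  by rewrite mulr0 big1 // => z _; rewrite mulr0.
rewrite (mn_mulE uA); first by rewrite mulr_suml.
move=> z fz gz; rewrite mem_undup mem_cat AP1 ?orbT //; split=> //.
by exists (z^-1 * y)%g, (y^-1 * x)%g; split=> //; rewrite -mulgA mulVKg.
Qed.

Lemma mn_mul1f f : mn_mul (@mn_one G K) f = f.
Proof.
apply: funext => x; rewrite (@mn_mulE _ _ _ [:: 1%g]) //.
  by rewrite big_seq1 mn_oneE eqxx mul1r invg1 mul1g.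
by move=> y; rewrite mn_oneE inE; case: (y == 1%g) => //; rewrite eqxx.
Qed.

Lemma mn_mulf1 f : mn_mul f (@mn_one G K) = f.
Proof.
apply: funext => x; rewrite (@mn_mulE _ _ _ [:: x]) //.
  by rewrite big_seq1 mn_oneE mulVg eqxx mulr1.
move=> y _; rewrite mn_oneE inE; have [/eqP|] := eqVneq (y^-1 * x)%g 1%g.
  by rewrite mulg_eq1 => /eqP/invg_inj ->.
by rewrite eqxx.
Qed.

Lemma mn_mulDl f g h : is_series f -> is_series g -> is_series h ->
  mn_mul (mn_add f g) h = mn_add (mn_mul f h) (mn_mul g h).
Proof.
move=> sf sg sh; apply: funext => x.
have [s sP] := wo_fiber x (wo_union sf sg) sh.
have us := undup_uniq s.
rewrite /mn_add !(mn_mulE us) -?big_split /=; first by apply: eq_bigr => y _; rewrite mulrDl.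
- by move=> y gy hy; rewrite mem_undup sP //; split=> //; right.
- by move=> y fy hy; rewrite mem_undup sP //; split=> //; left.
move=> y fgy hy; rewrite mem_undup sP //; split=> //.
have [f0|f0] := eqVneq (f y) 0; [right|by left].
by move: fgy; rewrite f0 add0r.
Qed.

Lemma mn_mulDr f g h : is_series f -> is_series g -> is_series h ->
  mn_mul h (mn_add f g) = mn_add (mn_mul h f) (mn_mul h g).
Proof.
move=> sf sg sh; apply: funext => x.
have [s sP] := wo_fiber x sh (wo_union sf sg).
have us := undup_uniq s.
rewrite /mn_add !(mn_mulE us) -?big_split /=; first by apply: eq_bigr => y _; rewrite mulrDr.
- by move=> y hy gy; rewrite mem_undup sP //; split=> //; right.
- by move=> y hy fy; rewrite mem_undup sP //; split=> //; left.
move=> y hy fgy; rewrite mem_undup sP //; split=> //.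
have [f0|f0] := eqVneq (f (y^-1 * x)%g) 0; [right|by left].
by move: fgy; rewrite f0 add0r.
Qed.

End Product.

Arguments is_series_add {G K f g}.
Arguments is_series_mul {G K f g}.
Arguments is_series_opp {G K f}.
Arguments is_series_finite {G K f}.
Arguments is_series_zero {G K}.
Arguments is_series_one {G K}.
Arguments wo_union {G A B}.
Arguments wo_mul {G A B}.
Arguments wo_finite {G A}.

(** * The skew field of series *)

Section MalcevNeumannRing.
Variables (G : ordgroup) (K : unitRingType).
Local Open Scope ring_scope.

Record mn := Series { mnf :> G -> K; mnP : is_series mnf }.
Arguments mnP : clear implicits.

HB.instance Definition _ := gen_eqMixin mn.
HB.instance Definition _ := gen_choiceMixin mn.

Implicit Types (f g h : mn) (x y z : G).

Lemma mn_ext f g : f =1 g -> f = g.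
Proof.
case: f g => [f sf] [g sg] /funext /= fg; subst g.
by congr Series; apply: Prop_irrelevance.
Qed.

Definition mnadd f g := Series (is_series_add (mnP f) (mnP g)).
Definition mnopp f := Series (is_series_opp (mnP f)).
Definition mnmul f g := Series (is_series_mul (mnP f) (mnP g)).
Definition mn0 := Series (@is_series_zero G K).
Definition mn1 := Series (@is_series_one G K).

Fact mnaddA : associative mnadd.
Proof. by move=> f g h; apply: mn_ext => x; apply: addrA. Qed.
Fact mnaddC : commutative mnadd.
Proof. by move=> f g; apply: mn_ext => x; apply: addrC. Qed.
Fact mnadd0 : left_id mn0 mnadd.
Proof. by move=> f; apply: mn_ext => x; apply: add0r. Qed.
Fact mnaddN : left_inverse mn0 mnopp mnadd.
Proof. by move=> f; apply: mn_ext => x; apply: addNr. Qed.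

HB.instance Definition _ := GRing.isZmodule.Build mn mnaddA mnaddC mnadd0 mnaddN.

Fact mnmulA : associative mnmul.
Proof. by move=> f g h; apply: mn_ext => x /=; rewrite mn_mulA //; apply: mnP. Qed.
Fact mnmul1f : left_id mn1 mnmul.
Proof. by move=> f; apply: mn_ext => x /=; rewrite mn_mul1f. Qed.
Fact mnmulf1 : right_id mn1 mnmul.
Proof. by move=> f; apply: mn_ext => x /=; rewrite mn_mulf1. Qed.
Fact mnmulDl : left_distributive mnmul mnadd.
Proof. by move=> f g h; apply: mn_ext => x /=; rewrite mn_mulDl //; apply: mnP. Qed.
Fact mnmulDr : right_distributive mnmul mnadd.
Proof. by move=> f g h; apply: mn_ext => x /=; rewrite mn_mulDr //; apply: mnP. Qed.
Fact mn1_neq0 : mn1 != mn0.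
Proof.
apply/eqP => /(congr1 (fun f : mn => f 1%g)) /=; rewrite mn_oneE eqxx.
by apply/eqP/oner_neq0.
Qed.

HB.instance Definition _ := GRing.Zmodule_isNzRing.Build mn
  mnmulA mnmul1f mnmulf1 mnmulDl mnmulDr mn1_neq0.

Definition mnunit : pred mn := fun f => `[< exists g, g * f = 1 /\ f * g = 1 >].
Definition mninv f : mn :=
  if pselect (exists g, g * f = 1 /\ f * g = 1) is left e then sval (cid e) else f.

Fact mnmulVr : {in mnunit, left_inverse 1 mninv *%R}.
Proof.
move=> f /asboolP uf; rewrite /mninv; case: pselect => // e.
by case: (cid e) => g [].
Qed.
Fact mnmulrV : {in mnunit, right_inverse 1 mninv *%R}.
Proof.
move=> f /asboolP uf; rewrite /mninv; case: pselect => // e.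
by case: (cid e) => g [].
Qed.
Fact mnunitP f g : g * f = 1 /\ f * g = 1 -> mnunit f.
Proof. by move=> gf; apply/asboolP; exists g. Qed.
Fact mninv_out : {in [predC mnunit], mninv =1 id}.
Proof.
move=> f /negP nf; rewrite /mninv; case: pselect => // e.
by case: nf; apply/asboolP.
Qed.

HB.instance Definition _ := GRing.NzRing_hasMulInverse.Build mn
  mnmulVr mnmulrV mnunitP mninv_out.

Lemma mnDE f g x : (f + g) x = f x + g x. Proof. by []. Qed.
Lemma mnNE f x : (- f) x = - f x. Proof. by []. Qed.
Lemma mnBE f g x : (f - g) x = f x - g x. Proof. by []. Qed.
Lemma mn0E x : (0 : mn) x = 0. Proof. by []. Qed.
Lemma mn1E x : (1 : mn) x = if x == 1%g then 1 else 0.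
Proof. exact: mn_oneE. Qed.

Lemma mn_neq0 f : f != 0 -> exists x, f x != 0.
Proof.
move=> f0; apply: contrapT => H; move/eqP: f0; apply; apply: mn_ext => x.
by apply/eqP; apply: contrapT => /negP ?; apply: H; exists x.
Qed.

Lemma mn_lead f : f != 0 -> exists m, f m != 0 /\ forall y, f y != 0 -> (m <= y)%O.
Proof. by move/mn_neq0 => ex; apply: (wo_min (mnP f)) ex. Qed.

Lemma mnmulE f g x (s : seq G) : uniq s ->
  (forall y, f y != 0 -> g (y^-1 * x)%g != 0 -> y \in s) ->
  (f * g) x = \sum_(y <- s) f y * g (y^-1 * x)%g.
Proof. exact: mn_mulE. Qed.

Lemma mn_supp_mul f g x : (f * g) x != 0 ->
  exists a b, [/\ f a != 0, g b != 0 & x = (a * b)%g].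
Proof. by move/(supp_mul (mnP f) (mnP g)). Qed.

Lemma mnmul_ext f g g' x x' :
  (forall y, f y != 0 -> g (y^-1 * x)%g = g' (y^-1 * x')%g) -> (f * g) x = (f * g') x'.
Proof.
move=> gg'; have [s us sP] := supp_fiber x (mnP f) (mnP g).
rewrite !(mnmulE us) //; last by move=> y fy gy; apply: sP; rewrite ?gg'.
by apply: eq_bigr => y _; have [->|/gg' ->] := eqVneq (f y) 0; rewrite ?mul0r.
Qed.

Lemma mono_series x (a : K) : is_series (fun y : G => if y == x then a else 0).
Proof.
apply: wo_finite; exists [:: x] => y; rewrite /supp inE.
by case: (y == x) => //; rewrite eqxx.
Qed.

Definition mono x a : mn := Series (@mono_series x a).

Lemma monoE x a y : mono x a y = if y == x then a else 0. Proof. by []. Qed.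

Lemma mul_mono x a f y : (mono x a * f) y = a * f (x^-1 * y)%g.
Proof.
rewrite (@mnmulE _ _ _ [:: x]) ?big_seq1 ?monoE ?eqxx // => z.
by rewrite monoE inE; case: (z == x) => //; rewrite eqxx.
Qed.

Lemma mul_to_mono x a f y : (f * mono x a) y = f (y * x^-1)%g * a.
Proof.
rewrite (@mnmulE _ _ _ [:: (y * x^-1)%g]) ?big_seq1.
- by rewrite monoE invgM invgK -mulgA mulVg mulg1 eqxx.
- by [].
move=> z _; rewrite monoE inE; have [<- _|_] := eqVneq (z^-1 * y)%g x; last by rewrite eqxx.
by rewrite invgM invgK mulVKg.
Qed.

Definition grp x : mn := mono x 1.

Lemma mul_grp x f y : (grp x * f) y = f (x^-1 * y)%g.
Proof. by rewrite mul_mono mul1r. Qed.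

Lemma mul_to_grp x f y : (f * grp x) y = f (y * x^-1)%g.
Proof. by rewrite mul_to_mono mulr1. Qed.

Lemma grp1 : grp 1%g = 1.
Proof. by apply: mn_ext => x; rewrite mn1E. Qed.

Lemma grpM x y : grp (x * y)%g = grp x * grp y.
Proof.
apply: mn_ext => z; rewrite mul_grp !monoE; congr (if _ then _ else _).
by apply/eqP/eqP => [->|<-]; rewrite ?mulKg ?mulVKg.
Qed.

Lemma grp_unit x : grp x \is a GRing.unit.
Proof.
by apply/unitrP; exists (grp x^-1%g); rewrite -!grpM mulVg mulgV grp1.
Qed.

Lemma grpV x : grp x^-1%g = (grp x)^-1.
Proof.
by apply: (mulrI (grp_unit x)); rewrite mulrV ?grp_unit // -grpM mulgV grp1.
Qed.

Lemma grp_inj : injective grp.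
Proof.
move=> x y /(congr1 (fun f : mn => f x)); rewrite !monoE eqxx.
by have [//|_ /eqP] := eqVneq x y; rewrite oner_eq0.
Qed.

(* An element of the support moved by conjugation with [x] would, together with
   its conjugates, form a subset of the support without a minimum. *)
Lemma commute_supp x f : f * grp x = grp x * f -> forall y, f y != 0 -> commute x y.
Proof.
move=> fx y fy; apply: contrapT => xy.
have fJ z : f (x * z * x^-1)%g = f z.
  by rewrite -mul_to_grp fx mul_grp mulKg.
have [||m [[fm xm] mP]] := @wo_min _ _ (fun z => f z != 0 /\ ~ commute x z) (mnP f).
- by move=> z [].
- by exists y.
have le1 : (m <= (x * m * x^-1)%g)%O.
  apply: mP; rewrite fJ; split=> // C; apply: xm.
  by move: C; rewrite /commute mulgVK => /mulgI C; rewrite -[in RHS]C mulgVK.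
have le2 : (m <= (x^-1 * m * x)%g)%O.
  apply: mP; rewrite -fJ !mulgA mulgV mul1g mulgK; split=> // C; apply: xm.
  move: C; rewrite /commute !mulgA mulgV mul1g => /mulIg C.
  by rewrite [in LHS]C !mulgA mulgV mul1g.
apply: xm; rewrite /commute; apply/eqP; rewrite eq_le.
move: le1 le2; rewrite -(og_leM2r x) mulgVK => ->.
by rewrite -(og_leM2l x) !mulgA mulgV mul1g => ->.
Qed.

(** * Inverses of series over a skew field *)

Section SkewField.
Hypothesis K_skew : forall a : K, a != 0 -> a \is a GRing.unit.

Lemma K_mul_eq0 (a b : K) : a * b = 0 -> a = 0 \/ b = 0.
Proof.
move=> ab; have [->|/K_skew ua] := eqVneq a 0; [by left|right].
by apply: (mulrI ua); rewrite ab mulr0.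
Qed.

Section RightInverse.
Variables (f : mn) (m : G).
Hypotheses (fm : f m != 0) (mP : forall y, f y != 0 -> (m <= y)%O).

(* Zorn's lemma on initial parts of the inverse. No combinatorics of the monoid
   generated by the support is needed: in a chain every support is an initial
   segment of the next ones, so the union of the supports is well-ordered. *)
Let approx g := forall u v, g u != 0 -> (1 - f * g) v != 0 -> ((m * u)%g < v)%O.
Let T := {g : mn | approx g}.
Let R (g h : T) := `[< forall u w, sval g w != 0 -> (u <= w)%O -> sval h u = sval g u >].

Lemma right_inverse_lead : exists g, f * g = 1.
Proof.
have Rrefl t : R t t by apply/asboolP.
have Rtrans r s t : R r s -> R s t -> R r t.
  move=> /asboolP rs /asboolP st; apply/asboolP => u w rw uw.
  by rewrite (st u w) ?(rs u w) // (rs w w).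
have Ranti s t : R s t -> R t s -> s = t.
  move=> /asboolP st /asboolP ts; case: s t st ts => [g Pg] [h Ph] /= st ts.
  suff gh : g = h by subst h; congr exist; apply: Prop_irrelevance.
  apply: mn_ext => u; have [g0|gu] := eqVneq (g u) 0; last by rewrite (st u u).
  by have [->//|hu] := eqVneq (h u) 0; rewrite (ts u u).
have Rchain (A : set T) : total_on A R -> exists t, forall s, A s -> R s t.
  move=> Atot.
  pose ex u := exists2 s, A s & sval s u != 0.
  (* The union of the chain: the value at [u] is that of a member whose support contains [u], and 0
     if there is none. *)
  pose l u : K := if pselect (ex u) is left e then sval (projT1 (cid2 e)) u else 0.
  have lE s u w : A s -> sval s w != 0 -> (u <= w)%O -> l u = sval s u.
    move=> As sw uw; rewrite /l; case: pselect => [e|ne].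
      case: (cid2 e) => t At tu /=.
      have [/asboolP st|/asboolP ts] := Atot s t As At; first exact: (st u w).
      by rewrite (ts u u).
    by apply/eqP; rewrite eq_sym; apply: contrapT => /negP su; apply: ne; exists s.
  have lex u : l u != 0 -> exists2 s, A s & sval s u != 0.
    by rewrite /l; case: pselect => //; rewrite eqxx.
  have sl : is_series l.
    apply: woP => P Pl [x Px]; have [s As sx] := lex x (Pl x Px).
    have [||y [[Py sy] yP]] := @wo_min _ _ (fun u => P u /\ sval s u != 0) (mnP (sval s)).
    - by move=> u [].
    - by exists x.
    exists y; split=> // z Pz; rewrite leNgt; apply/negP => zy.
    have lz : l z != 0 := Pl z Pz.
    have sz : sval s z != 0 by rewrite -(lE s z y) ?(ltW zy).
    by have := yP z (conj Pz sz); rewrite leNgt zy.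
  have Pl : approx (Series sl).
    move=> u v /lex[s As su]; rewrite ltNge => lv; apply/negP => vu.
    suff sv : (1 - f * sval s) v != 0 by have := svalP s u v su sv; rewrite ltNge vu.
    move: lv; rewrite !mnBE (@mnmul_ext f _ (sval s) v v) // => y /mP my /=.
    by apply: (lE s _ u) => //; rewrite -(og_leM2l y) mulVKg (le_trans vu) ?og_leM2r.
  exists (exist _ _ Pl) => s As; apply/asboolP => u w sw uw /=; exact: (lE s u w).
have [[g Pg] gmax] := Zorn Rrefl Rtrans Ranti Rchain.
exists g; apply/eqP; rewrite eq_sym -subr_eq0; apply: contrapT => /negP r0.
have [v [rv vP]] := mn_lead r0.
(* The term with exponent [m^-1 * v] and coefficient [b] cancels the leading term of the remainder
   and lies beyond the support of [g], so [g] was not maximal. *)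
pose b := (f m)^-1 * (1 - f * g) v.
pose g' := g + mono (m^-1 * v)%g b.
have gu u : g u != 0 -> (u < (m^-1 * v)%g)%O.
  by move=> gu; rewrite -(og_ltM2l m) mulVKg; apply: (Pg).
have r'P x : (1 - f * g') x != 0 -> (v < x)%O.
  rewrite mulrDr opprD addrA mnBE mul_to_mono invgM invgK => r'x.
  rewrite ltNge; apply/negP => xv; move/eqP: r'x; apply.
  move: xv; rewrite le_eqVlt => /orP[/eqP ->|xv].
    by rewrite mulgA mulgV mul1g mulVKr ?subrr //; apply: K_skew.
  have -> : (1 - f * g) x = 0.
    by apply/eqP; apply: contrapT => /negP/vP; rewrite leNgt xv.
  have -> : f (x * (v^-1 * m))%g = 0; last by rewrite mul0r subr0.
  apply/eqP; apply: contrapT => /negP/mP; rewrite leNgt.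
  by rewrite -[X in (_ < X)%O]mul1g mulgA og_ltM2r -(og_ltM2r v) mulgVK mul1g xv.
have Pg' : approx g'.
  move=> u x; rewrite mnDE monoE => g'u /r'P vx.
  have [uE|nu] := eqVneq u (m^-1 * v)%g; first by rewrite uE mulVKg.
  move: g'u; rewrite (negPf nu) addr0 => /gu.
  by rewrite -(og_ltM2l m) mulVKg => /lt_trans; apply.
have Rg : R (exist _ _ Pg) (exist _ _ Pg').
  apply/asboolP => u w /gu wv uw; change (g' u = g u); rewrite mnDE monoE.
  by have /lt_eqF -> := le_lt_trans uw wv; rewrite addr0.
have /(congr1 sval) /= := gmax _ Rg; rewrite /g' => /eqP.
rewrite -subr_eq0 addrAC subrr add0r => /eqP/(congr1 (fun h : mn => h (m^-1 * v)%g)).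
rewrite monoE eqxx => /K_mul_eq0[/eqP|/eqP]; last by rewrite (negPf rv).
by rewrite invr_eq0 (negPf fm).
Qed.

End RightInverse.

Lemma mn_mul_eq0 f g : f * g = 0 -> f = 0 \/ g = 0.
Proof.
move=> fg; have [->|f0] := eqVneq f 0; [by left|right].
have [//|g0] := eqVneq g 0.
have [m [fm mP]] := mn_lead f0; have [k [gk kP]] := mn_lead g0.
have : (f * g) (m * k)%g = 0 by rewrite fg.
rewrite (@mnmulE _ _ _ [:: m]) ?big_seq1 ?mulKg //.
  by move/K_mul_eq0; move: fm gk => /eqP fm /eqP gk [].
move=> y fy gy; rewrite inE eq_le mP // andbT.
by move: (kP _ gy); rewrite -(og_leM2l y) mulVKg og_leM2r.
Qed.

(** If [g] is a right inverse of [f] and [k] one of [g], then [f = k], so [g] is a two-sided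
    inverse. *)
Lemma mn_skew f : f != 0 -> f \is a GRing.unit.
Proof.
have rinv h : h != 0 -> exists g, h * g = 1.
  by move=> /mn_lead[m [fm mP]]; apply: right_inverse_lead fm mP.
move=> f0; have [g fg] := rinv f f0.
have g0 : g != 0 by apply: contra_eq_neq fg => ->; rewrite mulr0 eq_sym oner_neq0.
have [k gk] := rinv g g0.
have fk : f = k by rewrite -[LHS]mulr1 -gk mulrA fg mul1r.
by apply/unitrP; exists g; rewrite {1}fk.
Qed.

End SkewField.
End MalcevNeumannRing.

Arguments mnP {G K} _.

(** * The skew field K(G) and words in the generators *)

Section GeneratedSkewField.
Variables (G : ordgroup) (K : unitRingType).
Local Open Scope ring_scope.
Local Notation D := (mn G K).
Implicit Types (f g h : D) (x y : G).

Lemma in_KG_series (f : G -> K) : in_KG f -> is_series f.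
Proof.
elim=> {f} [f|f g _ + _|f _|f g _ + _|f g _ _ _ sg _ _|f g _ sf fg].
- exact: is_series_finite.
- exact: is_series_add.
- exact: is_series_opp.
- exact: is_series_mul.
- exact: sg.
by have <- : f = g by apply: funext.
Qed.

Lemma feqE f g : feq f g <-> f = g.
Proof. by split=> [fg|->//]; apply: mn_ext. Qed.

Definition KG f := in_KG f.

Lemma KG_grp x : KG (grp K x).
Proof.
apply: KG_ring; exists [:: x] => y; rewrite [X in X != 0]monoE.
by have [->|_] := eqVneq y x; [left|rewrite eqxx].
Qed.

Lemma KG1 : KG 1. Proof. by rewrite -(grp1 G K); apply: KG_grp. Qed.

Lemma KGM f g : KG f -> KG g -> KG (f * g). Proof. exact: KG_mul. Qed.

Lemma KGB f g : KG f -> KG g -> KG (f - g).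
Proof. by move=> Kf Kg; apply: KG_add => //; apply: KG_opp. Qed.

Lemma KGV f : f \is a GRing.unit -> KG f -> KG f^-1.
Proof.
move=> uf Kf; apply: (KG_inv (f := f)) => //; first last.
- by apply/(feqE (f^-1 * f) 1)/mulVr.
- by apply/(feqE (f * f^-1) 1)/mulrV.
- exact: mnP.
by move/(feqE f 0) => f0; move: uf; rewrite f0 unitr0.
Qed.

Definition letter := (bool * bool)%type.
Definition linv (l : letter) : letter := (l.1, ~~ l.2).
Definition redb : word bool -> bool := sorted (fun a b : letter => b != linv a).

Lemma linvK : involutive linv. Proof. by case=> i b; rewrite /linv negbK. Qed.

Lemma linv_neq l : linv l != l.
Proof. by case: l => -[] []. Qed.

Lemma redbP w : reduced w <-> redb w.
Proof.
elim: w => // a [|b w] //= [IH1 IH2]; split.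
  move=> [ab /IH1 /= ->]; rewrite andbT; apply/eqP => bE; apply: ab.
  by rewrite bE /=; split=> //; case: a.2.
case/andP=> /eqP ab /IH2 rw; split=> // -[e1 e2]; apply: ab.
by case: a b e1 e2 {IH1 IH2 rw} => [i []] [j []] //= -> //.
Qed.

Section Generators.
Variable t : letter -> G.

Definition gen (l : letter) : D := (1 - grp K (t (linv l))) * (1 - grp K (t l))^-1.

Definition ev : word bool -> D := foldr (fun l acc => gen l * acc) 1.

Lemma ev_cons l w : ev (l :: w) = gen l * ev w. Proof. by []. Qed.

Lemma evalE w :
  eval_word (fun i => gen (i, false)) (fun i => gen (i, true)) w = mnf (ev w).
Proof. by elim: w => [|[i []] w IH] //=; rewrite IH. Qed.

Hypothesis K_skew : forall a : K, a != 0 -> a \is a GRing.unit.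
Hypothesis t_neq1 : forall l, t l <> 1%g.

Lemma sub_unit l : 1 - grp K (t l) \is a GRing.unit.
Proof.
apply: mn_skew => //; rewrite subr_eq0 -grp1; apply/eqP => /grp_inj/esym.
exact: t_neq1.
Qed.

Lemma gen_linv l : gen l * gen (linv l) = 1.
Proof.
by rewrite /gen linvK mulrA mulrVK ?mulrV // sub_unit.
Qed.

Lemma KG_gen l : KG (gen l).
Proof.
have KG_sub k : KG (1 - grp K (t k)) by apply: KGB; [apply: KG1|apply: KG_grp].
by apply: KGM => //; apply: KGV => //; apply: sub_unit.
Qed.

Lemma ev_reduce w : exists2 w', redb w' & ev w = ev w'.
Proof.
elim: w => [|l w [w' rw' IH]]; first by exists [::].
case: w' rw' IH => [_ IH|k w' rw' IH]; first by exists [:: l]; rewrite // ev_cons IH.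
have [kl|kl] := eqVneq k (linv l).
  exists w'; first exact: path_sorted rw'.
  by rewrite ev_cons IH ev_cons kl mulrA gen_linv mul1r.
by exists (l :: k :: w'); [rewrite /redb /= kl|rewrite ev_cons IH].
Qed.

Definition central_supp f := forall x, f x != 0 -> forall g : G, commute g x.

(* Linear independence of the reduced words over the larger field of all
   series supported in the centre of the group. *)
Definition independent := forall n (z : nat -> D) (w : nat -> word bool),
  (forall k, (k < n)%N -> central_supp (z k)) ->
  (forall k, (k < n)%N -> redb (w k)) ->
  (forall k l, (k < n)%N -> (l < n)%N -> k <> l -> w k <> w l) ->
  \sum_(0 <= k < n) z k * ev (w k) = 0 -> forall k, (k < n)%N -> z k = 0.

(** The group elements lie in K(G), so a central [z] commutes with each of them and [commute_supp]
    applies. *)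
Lemma in_center_supp (z : G -> K) (sz : is_series z) :
  in_center z -> central_supp (Series sz).
Proof.
move=> [_ zP] x zx g; apply: (commute_supp _ zx).
by apply/feqE; apply: zP; apply: KG_grp.
Qed.

Lemma mn_sumE n (F : nat -> D) : mn_sum n (fun k => F k) = mnf (\sum_(0 <= k < n) F k).
Proof.
elim: n => [|n IH]; first by rewrite big_nil.
by rewrite big_nat_recr //= IH.
Qed.

Lemma mn_sum_ext n (F F' : nat -> G -> K) :
  (forall k, (k < n)%N -> F k = F' k) -> mn_sum n F = mn_sum n F'.
Proof.
elim: n => //= n IH FF'; rewrite FF' // IH // => k kn.
by apply: FF'; apply: ltnW.
Qed.

Lemma independent_free : independent ->
  free_gens (fun i => gen (i, false)) (fun i => gen (i, true)).
Proof.
move=> ind w /redbP rw w0; rewrite evalE => /(feqE _ 1) ew.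
have cs1 : central_supp 1.
  by move=> x; rewrite mn1E => + g; have [->|_] := eqVneq x 1%g; [rewrite /commute mulg1 mul1g|rewrite eqxx].
pose z k : D := if k is 0 then 1 else - 1.
have : z 0 = 0; last by apply/eqP; rewrite oner_eq0.
apply: (ind 2 z (fun k => if k is 0 then w else [::])) => //.
- case=> [_|[_|//]] x; first exact: cs1.
  by rewrite mnNE oppr_eq0; apply: cs1.
- by case=> [_|[_|//]].
- by case=> [|[|//]] [|[|//]] // _ _ _ /esym.
by rewrite !big_nat_recl // big_nil /z ew !mul1r /ev /= mulr1 addr0 subrr.
Qed.

(** Words with distinct values have distinct reduced forms, so a relation between arbitrary words
    becomes one between distinct reduced words. *)
Lemma independent_center_lin_indep : independent ->
  center_lin_indep (fun i => gen (i, false)) (fun i => gen (i, true)).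
Proof.
move=> ind n z w zc wd; pose ser k := pselect (is_series (z k)).
(* For [k >= n] nothing is known about [z k]; 0 stands in for what is not a series. *)
pose Z k : D := if ser k is left sz then Series sz else 0.
have ZE k : (k < n)%N -> z k = mnf (Z k).
  move=> kn; rewrite /Z; case: (ser k) => // nsz; case: nsz.
  exact/in_KG_series/(zc k kn).1.
pose r k := s2val (cid2 (ev_reduce (w k))).
have rP k : redb (r k) by rewrite /r; case: cid2.
have rE k : ev (w k) = ev (r k) by rewrite /r; case: cid2.
rewrite (@mn_sum_ext n _ (fun k => mnf (Z k * ev (r k)))); last first.
  by move=> k kn; rewrite evalE ZE // rE.
rewrite mn_sumE => /(feqE _ 0) sum0 k kn; rewrite ZE //; apply/(feqE _ 0).
apply: (ind n Z r _ _ _ sum0 k kn) => [j jn|//|j l jn ln jl].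
  rewrite /Z; case: (ser j) => [sz|_] x; last by rewrite mn0E eqxx.
  exact/in_center_supp/zc.
by move=> rjl; apply: (wd j l) => //; rewrite !evalE !rE rjl.
Qed.

Lemma independent_conclusion : independent ->
  exists (I : Type) (x xi : I -> G -> K),
    (exists i j : I, i <> j) /\
    (forall i, in_KG (x i) /\ in_KG (xi i) /\
               feq (mn_mul (x i) (xi i)) (@mn_one G K) /\
               feq (mn_mul (xi i) (x i)) (@mn_one G K)) /\
    free_gens x xi /\
    center_lin_indep x xi.
Proof.
move=> ind; exists bool, (fun i => gen (i, false)), (fun i => gen (i, true)).
split; first by exists true, false.
split; last by split; [apply: independent_free|apply: independent_center_lin_indep].
move=> i; split; first exact: KG_gen.
split; first exact: KG_gen.
by split; [apply/(feqE (gen _ * gen _) 1)/(gen_linv (i, false))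
  |apply/(feqE (gen _ * gen _) 1)/(gen_linv (i, true))].
Qed.

End Generators.
End GeneratedSkewField.

(** * Monoids that are free modulo the centre *)

Section FreeMonoid.
Variables (G : ordgroup) (K : unitRingType).
Local Open Scope ring_scope.
Local Notation D := (mn G K).
Variable t : letter -> G.
Hypothesis K_skew : forall a : K, a != 0 -> a \is a GRing.unit.
Hypothesis t_gt1 : forall l, ((1%g : G) < t l)%O.

Definition mword (u : word bool) : G := foldr (fun l acc => t l * acc)%g 1%g u.

Hypothesis t_free : forall u v (c : G), (forall g, commute g c) ->
  mword u = (c * mword v)%g -> u = v.

Let t_neq1 l : t l <> 1%g.
Proof. by move=> tl; move: (t_gt1 l); rewrite tl ltxx. Qed.

Lemma mword_inj : injective mword.
Proof.
move=> u v uv; apply: (@t_free u v 1%g); last by rewrite mul1g.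
by move=> g; rewrite /commute mulg1 mul1g.
Qed.

Let E := ev K t.
Let V l w : D := (1 - grp K (t l))^-1 * E w.

(** One step of the geometric series, [V l w = E w + t_l V l w], read off at [g]. *)
Let VE l w g : V l w g = V l w ((t l)^-1 * g)%g + E w g.
Proof.
have : (1 - grp K (t l)) * V l w = E w by rewrite mulrA mulrV ?mul1r // sub_unit.
by move=> <-; rewrite mulrBl mul1r mnBE mul_grp addrC subrK.
Qed.

Let EV l w g : E (l :: w) g = V l w g - V l w ((t (linv l))^-1 * g)%g.
Proof. by rewrite /E ev_cons /gen -mulrA mulrBl mul1r mnBE mul_grp. Qed.

Let inS g := exists u, g = mword u.

Let inSM l g : inS g -> inS (t l * g)%g.
Proof. by move=> [u ->]; exists (l :: u). Qed.

(** If [m] is the least exponent of [V l w] outside the monoid, the recursion makes [(t l)^-1 * m]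
    another one, and it is smaller because [t l > 1]. *)
Let supp_V l w : (forall g, E w g != 0 -> inS g) -> forall g, V l w g != 0 -> inS g.
Proof.
move=> EP g Vg; apply: contrapT => nS.
have [||m [[Vm nSm] mP]] := @wo_min _ _ (fun g => V l w g != 0 /\ ~ inS g) (mnP (V l w)).
- by move=> y [].
- by exists g.
have Em : E w m = 0 by apply/eqP; apply: contrapT => /negP/EP.
have Vm' : V l w ((t l)^-1 * m)%g != 0 by move: Vm; rewrite VE Em addr0.
have : (m <= ((t l)^-1 * m)%g)%O.
  by apply: mP; split=> // /(inSM l); rewrite mulVKg.
by rewrite leNgt -[X in (_ < X)%O]mul1g og_ltM2r og_ltV1 t_gt1.
Qed.

Lemma supp_ev w g : E w g != 0 -> exists u, g = mword u.
Proof.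
elim: w g => [|l w IH] g.
  rewrite mn1E; have [-> _|_] := eqVneq g 1%g; first by exists [::].
  by rewrite eqxx.
rewrite EV; have [V0|Vg] := eqVneq (V l w g) 0; last by move=> _; apply: supp_V Vg.
rewrite V0 sub0r oppr_eq0 => /(supp_V IH)/(inSM (linv l)).
by rewrite mulVKg.
Qed.

Let supp_VE l w g : V l w g != 0 -> inS g.
Proof. exact/supp_V/supp_ev. Qed.

Let V_head k l w u : ohead u != Some k -> V l w ((t k)^-1 * mword u)%g = 0.
Proof.
move=> hu; apply/eqP; apply: contrapT => /negP/supp_VE[v] /(congr1 (fun x => t k * x)%g).
by rewrite mulVKg -[RHS]/(mword (k :: v)) => /mword_inj uE; rewrite uE eqxx in hu.
Qed.

Definition stutter_free : word bool -> bool := sorted (fun a b : letter => b != a).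

Definition doubled (w : word bool) : word bool := flatten [seq [:: linv l; l] | l <- w].

Lemma size_doubled w : size (doubled w) = (2 * size w)%N.
Proof. by elim: w => //= l w ->; rewrite mulnS. Qed.

Lemma doubled_inj : injective doubled.
Proof.
elim=> [|l w IH] [|k v] // E1; have E2 : doubled w = doubled v by case: E1.
by rewrite (IH _ E2); case: E1 => _ _ ->.
Qed.

Lemma stutter_free_doubled w : redb w -> stutter_free (doubled w).
Proof.
elim: w => // l w IH /= rw; rewrite eq_sym linv_neq /=.
have {}IH := IH (path_sorted rw).
case: w rw IH => [|k w] //= /andP[kl _] ->; rewrite andbT.
by apply: contra_neq kl => <-; rewrite linvK.
Qed.

(* After expansion of the geometric series, a letter [l] of [v] contributes the
   terms [1], [t l ^+ n.+1] and [t (linv l) * t l ^+ n]; among the products of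
   [size v] of these, only the product of the [t (linv l) * t l] is stutter-free
   of length [2 * size v]. *)
Lemma ev_coef v u : stutter_free u -> (2 * size v <= size u)%N ->
  E v (mword u) = if u == doubled v then (- 1) ^+ size v else 0.
Proof.
elim: v u => [|l v IH] u su szu.
  by rewrite mn1E -[1%g]/(mword [::]) (inj_eq mword_inj).
have big x : stutter_free x -> (2 * size v < size x)%N -> E v (mword x) = 0.
  move=> sx szx; rewrite IH ?(ltnW szx) //; case: eqP => // xE.
  by rewrite xE size_doubled ltnn in szx.
have Vnl x : ohead x != Some l -> V l v (mword x) = E v (mword x).
  by move=> hx; rewrite VE V_head // add0r.
have Vne k x : k != l -> V l v (mword (k :: x)) = E v (mword (k :: x)).
  by move=> kl; apply: Vnl; apply: contra_neq kl => -[].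
have Vl x : V l v (mword (l :: x)) = V l v (mword x) + E v (mword (l :: x)).
  by rewrite VE /= mulKg.
(* A stutter-free word begins with at most one [l], so the geometric series in [t l] absorbs at most
   one letter of it. *)
have Vlong x : stutter_free x -> (2 * size v + 2 <= size x)%N -> V l v (mword x) = 0.
  case: x => [|k x] sx szx; first by rewrite addn2 in szx.
  have [kl|kl] := eqVneq k l; last by rewrite Vne ?big //; move: szx => /=; lia.
  rewrite kl in sx szx *; rewrite Vl Vnl; last by case: (x) sx => //= a ? /andP[].
  rewrite (big x) ?(big (l :: x)) ?addr0 //; first by move: szx => /=; lia.
    exact: path_sorted sx.
  by move: szx => /=; lia.
(* At this length only [- t (linv l) * V l v] contributes, which forces [u] to begin with [linv l]
   and then [l]. *)
rewrite EV Vlong //; last by move: szu => /=; lia.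
case: u su szu => [|k u] su szu //.
have [kl|kl] := eqVneq k (linv l); last first.
  rewrite V_head ?subr0; first by case: eqP => // -[/eqP]; rewrite (negPf kl).
  by apply: contra_neq kl => -[].
have tK k' x : ((t k')^-1 * mword (k' :: x))%g = mword x by rewrite /= mulKg.
have dE : doubled (l :: v) = linv l :: l :: doubled v by [].
rewrite kl in su szu *; rewrite tK dE eqseq_cons eqxx andTb.
have su' : stutter_free u := path_sorted su.
case: u su su' szu => [|j u] su su' szu; first by move: szu => /=; lia.
have [jl|jl] := eqVneq j l; last first.
  rewrite Vne // big //; first by rewrite subr0 eqseq_cons (negPf jl).
  by move: szu => /=; lia.
rewrite jl in su su' szu *; rewrite Vl Vnl; last by case: (u) su' => //= a ? /andP[].
rewrite (big (l :: u)) //; last by move: szu => /=; lia.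
rewrite IH ?eqseq_cons ?eqxx /=; last by move: szu => /=; lia.
  by case: eqP => _; rewrite ?exprS ?mulN1r ?addr0 sub0r ?oppr0.
exact: path_sorted su'.
Qed.

(** Freeness modulo the centre makes the factorisation into a central element and a monoid element
    unique, so the coefficient has a single contribution. *)
Lemma central_mul_coef (z : D) w c u : central_supp z -> (forall g, commute g c) ->
  (z * E w) (c * mword u)%g = z c * E w (mword u).
Proof.
move=> zc cc; rewrite (@mnmulE _ _ _ _ _ [:: c]) ?big_seq1 ?mulKg // => y zy.
move/supp_ev => [v yE]; rewrite inE.
have := @t_free u v (c^-1 * y)%g; rewrite -mulgA -yE mulVKg mulKg => uv.
have {uv} uv : u = v.
  by apply: uv => // g; apply: commuteM (zc y zy g); apply/commuteV/cc.
move: yE; rewrite uv mulgA -{2}[mword v]mul1g => /mulIg/eqP.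
by rewrite mulg_eq1 => /eqP/invg_inj ->.
Qed.

Lemma mn_sum_coef n (F : nat -> D) x :
  (\sum_(0 <= k < n) F k) x = \sum_(0 <= k < n) F k x.
Proof.
elim: n => [|n IH]; first by rewrite !big_nil.
by rewrite !big_nat_recr // mnDE IH.
Qed.

(** Let [w j] be a longest word with nonzero coefficient and [c] an exponent of [z j]. By [ev_coef],
    at [c * mword (doubled (w j))] only the term of [w j] survives, with value [z j c] up to
    sign. *)
Lemma free_monoid_independent : independent K t.
Proof.
move=> n z w zc rw wd sum0 k kn; apply/eqP; apply: contrapT => /negP zk.
have [/= j zj jmax] := @arg_maxnP _ (Ordinal kn) (fun j => z j != 0) (fun j => size (w j)) zk.
have [c zjc] := mn_neq0 zj.
have cc := zc j (ltn_ord j) c zjc.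
pose g := (c * mword (doubled (w j)))%g.
have : (z j * E (w j)) g = 0.
  have : (\sum_(0 <= k < n) z k * E (w k)) g = 0 by rewrite /E sum0.
  rewrite mn_sum_coef big_mkord (bigD1 j) // big1 => [<-|i ij].
    by rewrite [RHS]addr0.
  have [->|zi] := eqVneq (z i) 0; first by rewrite mul0r.
  rewrite central_mul_coef //; last exact: zc.
  rewrite ev_coef ?stutter_free_doubled ?rw ?size_doubled ?leq_mul2l ?jmax ?orbT //.
  case: eqP => [/doubled_inj ww|_]; last by rewrite mulr0.
  by case: (wd j i) => //; apply/eqP; rewrite eq_sym; exact: ij.
rewrite central_mul_coef //; last exact: zc.
rewrite ev_coef ?size_doubled ?eqxx ?stutter_free_doubled ?rw //.
move/(congr1 (fun a => a * (- 1) ^+ size (w j))); rewrite mul0r -mulrA -expr2 sqrr_sign mulr1.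
exact/eqP.
Qed.

End FreeMonoid.

(* If [i] is neither [l] nor [linv l], then [digit l] and [digit i] differ by at
   least 2, which exceeds the degree of [coef i] below. *)
Definition digit (l : letter) : nat := (3 * l.1 + l.2)%N.

Lemma digit_inj : injective digit.
Proof. by case=> [] [] [] [[] []]. Qed.

Lemma digit_le4 l : (digit l <= 4)%N.
Proof. by case: l => [] [] []. Qed.

(** * A free monoid from an expanding conjugation *)

Section Expanding.
Variable G : ordgroup.
Local Open Scope group_scope.
Local Open Scope order_scope.
Variables x y : G.
Hypotheses (x_gt1 : (1 : G) < x) (x_exp : x ^+ 16 <= x ^ y^-1).

Implicit Types (c d z : G) (u v : word bool) (a b l : letter).

Let t l := x ^+ digit l * y.
Let X n := x ^ (y ^+ n)^-1.
(** Moving all [y] to the right turns [mword t u] into a product of powers of the [X k] times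
    [y ^+ size u]. As [X k ^+ 16 <= X k.+1], [P u] resembles a number in base 16 with digits at most
    4, the last letter being the most significant. *)
Let P u := mword t u * (y ^+ size u)^-1.

Let X_gt1 n : (1 : G) < X n.
Proof. by rewrite -[1%g](conj1g (y ^+ n)^-1) og_ltJ. Qed.

Let XS n : X n ^+ 16 <= X n.+1.
Proof. by rewrite /X (expgSr y) invgM conjgM -conjXg og_leJ. Qed.

Let X_mono m n : (m <= n)%N -> X m <= X n.
Proof.
move/subnKC <-; elim: (n - m)%N => [|k IH]; first by rewrite addn0.
apply: le_trans IH _; rewrite addnS; apply: le_trans (XS _).
by rewrite -[leLHS]expg1 og_leX2l // ltW.
Qed.

Lemma mword_rcons (s : letter -> G) u a : mword s (rcons u a) = mword s u * s a.
Proof. by elim: u => [|b u IH] /=; rewrite ?mulg1 ?mul1g // IH mulgA. Qed.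

Let P_rcons u a : P (rcons u a) = P u * X (size u) ^+ digit a.
Proof.
by rewrite /P mword_rcons size_rcons (expgSr y) invgM /t /X -conjXg conjgE invgK !mulgA mulgK mulgVK.
Qed.

Let P_ge1 u : (1 : G) <= P u.
Proof.
elim/last_ind: u => [|u a IH]; first by rewrite /P /= mulgV.
by rewrite P_rcons -[leLHS]mulg1 og_leM // og_le1X // ltW.
Qed.

(** The lower digits never reach the next power; the factor [c < x] leaves room for a central
    error. *)
Let P_lt c u : c < x -> c * P u < X (size u).
Proof.
elim/last_ind: u c => [|u a IH] c cx.
  by rewrite /P /X /= invg1 mul1g mulg1 conjg1.
rewrite P_rcons size_rcons mulgA; apply: lt_le_trans (XS _).
apply: (@lt_le_trans _ _ (X (size u) * X (size u) ^+ digit a)).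
  by rewrite og_ltM2r IH.
rewrite -expgS; apply: og_leX2l; first exact: ltW.
by apply: leq_ltn_trans (digit_le4 a) _.
Qed.

Let P_le u a : P (rcons u a) <= X (size u) ^+ 5.
Proof.
rewrite P_rcons; apply: (@le_trans _ _ (X (size u) * X (size u) ^+ digit a)).
  by rewrite og_leM2r -[P u]mul1g ltW // P_lt.
by rewrite -expgS og_leX2l ?ltnS ?digit_le4 // ltW.
Qed.

Let mwordE u : mword t u = P u * y ^+ size u.
Proof. by rewrite /P mulgVK. Qed.

Let conj_mword u : x ^ (mword t u)^-1 = P u * X (size u) * (P u)^-1.
Proof. by rewrite mwordE invgM conjgM -/(X _) conjgE invgK mulgA. Qed.

Let conj_lt u : x ^ (mword t u)^-1 < X (size u) ^+ 2.
Proof.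
rewrite conj_mword; apply: (@le_lt_trans _ _ (P u * X (size u))).
  by rewrite -[leRHS]mulg1 og_leM2l -invg1 og_leV.
by rewrite expg2 og_ltM2r -[P u]mul1g P_lt.
Qed.

Let conj_ge u a : X (size u) ^+ 11 <= x ^ (mword t (rcons u a))^-1.
Proof.
rewrite conj_mword; apply: (@le_trans _ _ (X (size u) ^+ 16 * (X (size u) ^+ 5)^-1)).
  by rewrite (expgnDr _ 11 5) mulgK.
rewrite og_leM ?og_leV ?P_le // -[leLHS]mul1g og_leM //.
by rewrite size_rcons XS.
Qed.

(** The conjugate of [x] by the inverse of a word does not see the central factor [c]. It is at
    least [X n ^+ 11] for length [n.+1], where 11 is 16 minus the 5 of [P_le], and below [X n ^+ 2]
    for length at most [n]. *)
Let size_le u v c : (forall g, commute g c) -> mword t u = c * mword t v ->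
  (size u <= size v)%N.
Proof.
move=> cc uv; case/lastP: u uv => // u a uv; rewrite size_rcons ltnNge; apply/negP => vu.
have xE : x ^ (mword t (rcons u a))^-1 = x ^ (mword t v)^-1.
  rewrite uv -(cc (mword t v)) invgM conjgM; congr (_ ^ _).
  by rewrite conjgE invgK -(cc (x * _)) -mulgA mulVg mulg1.
have : X (size u) ^+ 11 < X (size v) ^+ 2.
  by rewrite (le_lt_trans (conj_ge u a)) // xE conj_lt.
have : X (size v) ^+ 2 <= X (size u) ^+ 11.
  apply: (@le_trans _ _ (X (size u) ^+ 2)); first exact/og_leX/X_mono.
  by rewrite og_leX2l // ltW.
by rewrite leNgt => /negP.
Qed.

(** If [digit a] were the smaller leading digit, then by [P_lt] the left side would stay below
    [X (size u) ^+ digit b] even after removing [c]. *)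
Let digit_ge u v a b c : (forall g, commute g c) -> c^-1 < x -> size u = size v ->
  P u * X (size u) ^+ digit a = c * (P v * X (size u) ^+ digit b) ->
  (digit b <= digit a)%N.
Proof.
move=> cc cx suv uv; rewrite leqNgt; apply/negP => ab.
have : c^-1 * P u * X (size u) ^+ digit a < X (size u) ^+ digit b.
  apply: (@lt_le_trans _ _ (X (size u) * X (size u) ^+ digit a)).
    by rewrite og_ltM2r P_lt.
  by rewrite -expgS og_leX2l // ltW.
apply/negP; rewrite -leNgt -mulgA uv mulKg -[leLHS]mul1g og_leM2r //.
Qed.

Let mword_free u v c : (forall g, commute g c) -> mword t u = c * mword t v -> u = v.
Proof.
move=> cc uv.
have cVc g : commute g c^-1 by apply/commuteV/cc.
have vu : mword t v = c^-1 * mword t u by rewrite uv mulKg.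
have suv : size u = size v.
  by apply/eqP; rewrite eqn_leq (size_le cc uv) (size_le cVc vu).
(* A central element below some conjugate of [x] is below [x] itself; this bounds both [c] and
   [c^-1], as [digit_ge] demands. *)
have small d z : (forall g, commute g d) -> d < x ^ z -> d < x.
  move=> dc; rewrite -(og_ltJ z^-1) conjgK; congr (_ < _).
  by rewrite conjgE invgK -(dc z^-1) mulVKg.
have Puv : P u = c * P v by rewrite /P uv suv mulgA.
have cx : c < x.
  apply: (small c (y ^+ size u)^-1) => //; rewrite -/(X _).
  apply: (@le_lt_trans _ _ (P u)); last by rewrite -[P u]mul1g P_lt.
  by rewrite Puv -[leLHS]mulg1 og_leM2l.
have cVx : c^-1 < x.
  apply: (small c^-1 (y ^+ size v)^-1) => //; rewrite -/(X _).
  apply: (@le_lt_trans _ _ (P v)); last by rewrite -[P v]mul1g P_lt.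
  by rewrite -[P v](mulKg c) -Puv -[leLHS]mulg1 og_leM2l.
have {small cx cVx cVc vu Puv} [cx cVx cVc] : [/\ c < x, c^-1 < x & forall g, commute g c^-1] by [].
elim/last_ind: u v uv suv => [|u a IH] v; first by case: v.
case/lastP: v => [|v b]; rewrite ?size_rcons // => uv [suv].
have Puv : P u * X (size u) ^+ digit a = c * (P v * X (size u) ^+ digit b).
  by rewrite -P_rcons suv -P_rcons /P uv !size_rcons suv mulgA.
have ab : a = b.
  apply/digit_inj/eqP; rewrite eqn_leq (digit_ge cc cVx suv Puv) andbT.
  apply: (digit_ge (u := v) (v := u) (c := c^-1)) => //; rewrite ?invgK //.
  by rewrite -suv Puv mulKg.
by move: uv; rewrite ab !mword_rcons (mulgA c) => /(@mulIg _ (t b))/IH -> //.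
Qed.

Let mword_inv u : mword (fun l => (t l)^-1) u = (mword t (rev u))^-1.
Proof.
elim: u => [|a u IH]; first by rewrite /= invg1.
by rewrite rev_cons mword_rcons invgM -IH.
Qed.

(** The alternatives make all [t l] greater than 1 or all smaller. In the second case the inverses
    are used, and freeness carries over by reversing words. *)
Lemma expanding_free : (1 : G) < y \/ x ^+ 4 * y <= (1 : G) ->
  exists s : letter -> G, (forall l, (1 : G) < s l) /\
  forall u v c, (forall g, commute g c) -> mword s u = c * mword s v -> u = v.
Proof.
case=> [y1|y1].
  exists t; split=> [l|]; last exact: mword_free.
  by apply: lt_le_trans y1 _; rewrite -[leLHS]mul1g og_leM2r og_le1X // ltW.
exists (fun l => (t l)^-1); split=> [l|u v c cc].
  rewrite og_lt1V lt_neqAle; apply/andP; split; last first.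
    by apply: le_trans y1; rewrite og_leM2r og_leX2l ?digit_le4 // ltW.
  (* If [t l = 1], then [y] is the inverse of a power of [x] and commutes with [x], against
     [x ^+ 16 <= x ^ y^-1]. *)
  apply/eqP => /eqP; rewrite mulg_eq1 => /eqP xy.
  move: x_exp; rewrite -xy (_ : x ^ _ = x); last first.
    by apply/conjg_fixP/commgP/commuteX.
  by rewrite leNgt -[X in X < _]expg1 og_ltX2l.
rewrite !mword_inv => /(congr1 (fun g => g^-1)); rewrite invgM !invgK.
have cVc g : commute g c^-1 by apply/commuteV/cc.
by rewrite cVc => /(mword_free cVc)/(can_inj revK).
Qed.

End Expanding.

Section ExpandingPower.
Variable G : ordgroup.
Local Open Scope group_scope.
Local Open Scope order_scope.

(** Replacing [y] by [y ^+ 4] raises the exponent 2 to 16. If [x ^+ 4 * y ^+ 4] exceeds 1, it takes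
    the place of [y ^+ 4]; its factor [x ^+ 4] commutes with [x]. *)
Lemma square_expanding_free (x y : G) : (1 : G) < x -> x ^+ 2 <= x ^ y^-1 ->
  exists s : letter -> G, (forall l, (1 : G) < s l) /\
  forall u v c, (forall g, commute g c) -> mword s u = c * mword s v -> u = v.
Proof.
move=> x1 xy.
have pow n : x ^+ (2 ^ n)%N <= x ^ (y ^+ n)^-1.
  elim: n => [|n IH]; first by rewrite invg1 conjg1.
  rewrite expnSr expgnA; apply: (@le_trans _ _ ((x ^ (y ^+ n)^-1) ^+ 2)); first exact: og_leX.
  by rewrite (expgSr y) invgM conjgM -conjXg og_leJ.
have x16 := pow 4%N.
have [y1|y1] := leP (x ^+ 4 * y ^+ 4) (1 : G).
  by apply: (expanding_free x1 x16); right.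
apply: (@expanding_free _ x (x ^+ 4 * y ^+ 4)) => //; last by left.
rewrite invgM conjgM -[x ^+ 16](conjgK (x ^+ 4)) conjXg.
rewrite (_ : x ^ x ^+ 4 = x); last by apply/conjg_fixP/commgP/commuteX.
by rewrite og_leJ.
Qed.

End ExpandingPower.

(** * Groups with slow conjugation *)

Section IntegerPower.
Variable G : groupType.
Local Open Scope group_scope.
Implicit Types (c : G) (a b : int).

Definition zpow c a : G :=
  match a with Posz n => c ^+ n | Negz n => (c ^+ n.+1)^-1 end.

Lemma zpowS c a : zpow c (a + 1)%R = zpow c a * c.
Proof.
case: a => [n|[|n]]; first by rewrite -PoszD addn1 /= expgSr.
  by rewrite /= mulVg.
have -> : (Negz n.+1 + 1)%R = Negz n by rewrite !NegzE; lia.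
by rewrite /= (expgS _ n.+1) invgM mulgVK.
Qed.

Lemma zpowD c a b : zpow c (a + b)%R = zpow c a * zpow c b.
Proof.
have pos n d : zpow c (d + n%:Z)%R = zpow c d * c ^+ n.
  elim: n => [|n IH]; first by rewrite addr0 mulg1.
  by rewrite -addn1 PoszD addrA zpowS IH addn1 expgSr mulgA.
case: b => n; first exact: pos.
apply: (mulIg (c ^+ n.+1)); rewrite mulgVK -pos; congr zpow.
by rewrite NegzE addrNK.
Qed.

Lemma zpow_opp c a : zpow c (- a)%R = (zpow c a)^-1.
Proof. by apply: (mulgI (zpow c a)); rewrite -zpowD subrr mulgV. Qed.

End IntegerPower.

Section SlowConjugation.
Variable G : ordgroup.
Local Open Scope group_scope.
Local Open Scope order_scope.
Implicit Types (c g h x y z : G).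

Hypothesis slow : forall x y, (1 : G) < x -> x ^ y < x ^+ 2.

(** One-sided smallness: for [c > 1] it holds for every [g <= 1]. The two-sided version is
    [small]. *)
Definition below c g := forall n, g ^+ n < c.

Lemma below_conj c g h : (1 : G) < c -> below c g -> below c (g ^ h).
Proof.
move=> c1 gc n; have [g1|g1] := leP g (1 : G).
  by apply: le_lt_trans c1; rewrite og_leX1 // -(conj1g h) og_leJ.
apply: le_lt_trans (gc (2 * n)%N).
by rewrite expgnA og_leX // ltW // slow.
Qed.

(** For [g <= h] one compares [(g * h) ^+ n] with [h ^+ (2 * n)]; the other case follows since
    [g * h] and [h * g] are conjugate. *)
Lemma belowM c g h : (1 : G) < c -> below c g -> below c h -> below c (g * h).
Proof.
move=> c1; wlog gh : g h / g <= h.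
  move=> H gc hc; have [gh|/ltW hg] := leP g h; first exact: H.
  have -> : g * h = (h * g) ^ h by rewrite conjgE -mulgA mulKg.
  by apply: below_conj => //; apply: H.
move=> _ hc n; have [h1|h1] := leP h (1 : G).
  apply: le_lt_trans c1; rewrite og_leX1 // -[leRHS]mulg1 og_leM //.
  exact: le_trans gh h1.
apply: le_lt_trans (hc (2 * n)%N); rewrite expgnA og_leX //.
by rewrite expg2 og_leM2r.
Qed.

(** With [x ^ y = u * x], the element [x ^ (y ^+ m)] is a product of [m] conjugates of [u] and of
    [x], and each conjugate [v] has [u < v ^+ 2]. If [x <= u ^+ n], then [m = 2 * n] gives at least
    [x ^+ 2], against [slow]. *)
Lemma below_commutator x y : (1 : G) < x -> below x (x ^ y * x^-1).
Proof.
move=> x1; set u := _ * _; move=> n; rewrite ltNge; apply/negP => xu.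
have xyE : x ^ y = u * x by rewrite mulgVK.
have [u1|u1] := leP u (1 : G).
  by have := lt_le_trans x1 (le_trans xu (og_leX1 n u1)); rewrite ltxx.
(* [v] is the least of the conjugates of [u] met so far. *)
have bound m : exists2 v, u < v ^+ 2 & v ^+ m * x <= x ^ (y ^+ m).
  elim: m => [|m [v uv vm]].
    exists u; first by rewrite -[ltLHS]expg1 og_ltX2l.
    by rewrite mul1g conjg1.
  have xS : x ^ (y ^+ m.+1) = u ^ (y ^+ m) * x ^ (y ^+ m).
    by rewrite expgS conjgM xyE conjMg.
  have um : u < (u ^ (y ^+ m)) ^+ 2.
    have := slow (y ^+ m)^-1 (_ : (1 : G) < u ^ (y ^+ m)).
    by rewrite conjgK; apply; rewrite -(conj1g (y ^+ m)) og_ltJ.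
  have v_le w : w <= v -> w ^+ m * x <= x ^ (y ^+ m).
    by move=> wv; apply: le_trans vm; rewrite og_leM2r og_leX.
  have [vu|uv'] := leP v (u ^ (y ^+ m)).
    by exists v => //; rewrite xS expgS -mulgA og_leM.
  exists (u ^ (y ^+ m)) => //; rewrite xS expgS -mulgA og_leM2l v_le //.
  exact: ltW.
have [v uv vn] := bound (2 * n)%N.
have : x ^ (y ^+ (2 * n)) < x ^+ 2 := slow _ x1.
apply/negP; rewrite -leNgt; apply: le_trans vn; rewrite expg2 og_leM2r.
by rewrite expgnA (le_trans xu) // og_leX // ltW.
Qed.

(** * The normal subgroup of infinitely small elements, and congruence modulo it *)

Section Convex.
Variable c : G.
Hypothesis c_gt1 : (1 : G) < c.

Definition small g := below c g /\ below c g^-1.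
Definition eqm g h := small (g * h^-1).

Lemma small1 : small (1 : G).
Proof. by split=> n; rewrite ?invg1 expg1n. Qed.

Lemma smallV g : small g -> small g^-1.
Proof. by case=> ? ?; split; rewrite ?invgK. Qed.

Lemma smallM g h : small g -> small h -> small (g * h).
Proof. by move=> [? ?] [? ?]; split; rewrite ?invgM; apply: belowM. Qed.

Lemma smallJ g h : small g -> small (g ^ h).
Proof. by move=> [? ?]; split; rewrite -?conjVg; apply: below_conj. Qed.

Lemma eqm_refl g : eqm g g.
Proof. by rewrite /eqm mulgV; apply: small1. Qed.

Lemma eqm_sym g h : eqm g h -> eqm h g.
Proof. by move/smallV; rewrite /eqm invgM invgK. Qed.

Lemma eqm_trans h g k : eqm g h -> eqm h k -> eqm g k.
Proof. by move=> gh /(smallM gh); rewrite /eqm mulgA mulgVK. Qed.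

Lemma eqmM g g' h h' : eqm g g' -> eqm h h' -> eqm (g * h) (g' * h').
Proof.
move=> gg' /(smallJ g^-1)/smallM/(_ gg'); rewrite /eqm conjgE invgK invgM !mulgA.
by rewrite mulgVK.
Qed.

Lemma eqm_Ml g h h' : eqm h h' -> eqm (g * h) (g * h').
Proof. by move=> H; apply: eqmM => //; apply: eqm_refl. Qed.

Lemma eqm_Mr g g' h : eqm g g' -> eqm (g * h) (g' * h).
Proof. by move=> H; apply: eqmM => //; apply: eqm_refl. Qed.

Lemma eqmV g h : eqm g h -> eqm g^-1 h^-1.
Proof.
move=> gh; have := eqm_Ml h^-1 (eqm_Mr g^-1 (eqm_sym gh)).
by rewrite mulgV mulg1 mulgA mulVg mul1g.
Qed.

Lemma small_zpow a : small (zpow c a) -> a = 0%R.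
Proof.
have pos n : (0 < n)%N -> ~ c ^+ n < c.
  by case: n => // n _; rewrite -[X in _ < X]expg1; apply/negP; rewrite -leNgt og_leX2l // ltW.
case: a => [[|n]|n] // [b1 b2]; exfalso.
  by apply: (pos n.+1) => //; have := b1 1%N.
by apply: (pos n.+1) => //; have := b2 1%N; rewrite invgK.
Qed.

Lemma eqm_zpow a b : eqm (zpow c a) (zpow c b) -> a = b.
Proof. by rewrite /eqm -zpow_opp -zpowD => /small_zpow; lia. Qed.

(** [below_commutator], for conjugation of [c] by [g^-1] and by [g], bounds the commutator and its
    inverse. *)
Lemma below_center g : eqm (g * c) (c * g).
Proof.
have e (h : G) : below c (c ^ h * c^-1) by apply: below_commutator.
rewrite /eqm invgM mulgA -[g * c * g^-1]mulgA -{1}[g]invgK -conjgE.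
split; first exact: e.
have -> : (c ^ g^-1 * c^-1)^-1 = (c ^ g * c^-1) ^ g^-1.
  by rewrite conjMg conjgK invgM invgK conjVg.
exact: below_conj.
Qed.

Lemma zpow_center g a : eqm (g * zpow c a) (zpow c a * g).
Proof.
have pos n : eqm (g * c ^+ n) (c ^+ n * g).
  elim: n => [|n IH]; first by rewrite mulg1 mul1g; apply: eqm_refl.
  rewrite expgS mulgA; apply: (eqm_trans (h := c * g * c ^+ n)).
    exact/eqm_Mr/below_center.
  by rewrite -!mulgA; apply: eqm_Ml.
case: a => n /=; first exact: pos.
have := eqm_Ml (c ^+ n.+1)^-1 (eqm_Mr (c ^+ n.+1)^-1 (eqm_sym (pos n.+1))).
by rewrite mulgK -mulgA mulKg.
Qed.

(** The commutator of [y] and [g] is the power [a] of [c] up to small elements. As [c] is central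
    modulo these, [a] is additive in [g] and in [y]. *)
Definition cdeg y a g := eqm (y * g * y^-1 * g^-1) (zpow c a).

Lemma eqmJ g h k : eqm g h -> eqm (g ^ k) (h ^ k).
Proof. by move=> gh; rewrite !conjgE; apply/eqm_Ml/eqm_Mr. Qed.

Lemma zpowJ k a : eqm (zpow c a ^ k) (zpow c a).
Proof.
rewrite conjgE mulgA; apply: eqm_sym.
by have := eqm_Ml k^-1 (zpow_center k a); rewrite mulKg mulgA.
Qed.

Lemma cdeg_uniq y a b g : cdeg y a g -> cdeg y b g -> a = b.
Proof. by move=> /eqm_sym ga gb; apply: eqm_zpow; apply: eqm_trans ga gb. Qed.

Lemma cdeg0 y g : commute y g -> cdeg y 0 g.
Proof. by rewrite /cdeg => ->; rewrite mulgK mulgV; apply: eqm_refl. Qed.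

Lemma cdeg1 y : cdeg y 0 (1 : G).
Proof. by apply: cdeg0; rewrite /commute mulg1 mul1g. Qed.

Lemma cdegM y a b g h : cdeg y a g -> cdeg y b h -> cdeg y (a + b) (g * h).
Proof.
rewrite /cdeg => ga hb.
have -> : y * (g * h) * y^-1 * (g * h)^-1 =
  y * g * y^-1 * g^-1 * (y * h * y^-1 * h^-1) ^ g^-1.
  by rewrite conjgE invgK invgM !mulgA !mulgVK.
by rewrite zpowD; apply: eqmM => //; apply: eqm_trans (zpowJ g^-1 b); apply: eqmJ.
Qed.

Lemma cdegMl y z a b g : cdeg y a g -> cdeg z b g -> cdeg (y * z) (a + b) g.
Proof.
rewrite /cdeg => ya zb.
have -> : y * z * g * (y * z)^-1 * g^-1 =
  (z * g * z^-1 * g^-1) ^ y^-1 * (y * g * y^-1 * g^-1).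
  by rewrite conjgE invgK invgM !mulgA !mulgVK.
by rewrite addrC zpowD; apply: eqmM => //; apply: eqm_trans (zpowJ y^-1 b); apply: eqmJ.
Qed.

Lemma cdegV y a g : cdeg y a g -> cdeg y (- a) g^-1.
Proof.
rewrite /cdeg => /eqmV ga.
have -> : y * g^-1 * y^-1 * g^-1^-1 = (y * g * y^-1 * g^-1)^-1 ^ g.
  by rewrite conjgE !invgM !invgK !mulgA mulVg mul1g.
by rewrite zpow_opp; apply: eqm_trans (eqmJ g ga) _; rewrite conjVg; apply/eqmV/zpowJ.
Qed.

Section Bidegree.
Variables x y : G.
Hypothesis yx : y * x = c * x * y.

(* Modulo [small], the elements [x] and [y] generate a Heisenberg group with
   central commutator [c]; an element of bidegree (a, b) is [x ^ a y ^ b] times an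
   element commuting with [x] and [y]. *)
Definition bideg (a b : int) g := cdeg y a g /\ cdeg x (- b)%R g.

Lemma bideg1 : bideg 0 0 (1 : G).
Proof. by split; apply: cdeg1. Qed.

Lemma bidegM a b a' b' g g' : bideg a b g -> bideg a' b' g' ->
  bideg (a + a') (b + b') (g * g').
Proof. by move=> [? ?] [? ?]; split; rewrite ?opprD; apply: cdegM. Qed.

Lemma bidegV a b g : bideg a b g -> bideg (- a) (- b) g^-1.
Proof. by move=> [? ?]; split; apply: cdegV. Qed.

Lemma bideg_uniq a b a' b' g : bideg a b g -> bideg a' b' g -> a = a' /\ b = b'.
Proof.
move=> [g1 g2] [g1' g2']; split; first exact: cdeg_uniq g1 g1'.
exact/oppr_inj/(cdeg_uniq g2 g2').
Qed.

Lemma bideg_x : bideg 1 0 x.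
Proof. by split; [rewrite /cdeg yx !mulgK; apply: eqm_refl|apply/cdeg0]. Qed.

Lemma bideg_y : bideg 0 1 y.
Proof.
split; first exact/cdeg0.
rewrite /cdeg; suff -> : x * y * x^-1 * y^-1 = c^-1 by apply: eqm_refl.
by apply: (mulgI c); rewrite !mulgA -yx mulgV mulgK mulgV.
Qed.

Lemma bideg_center g : (forall h, commute h g) -> bideg 0 0 g.
Proof. by move=> H; split; apply: cdeg0; apply: H. Qed.

(** [x] contributes 0 to the degree of [g] against [x ^+ k * y] and [y] contributes [a], while
    commuting elements have degree 0. *)
Lemma bideg_commute k a g : bideg a 0 g -> commute (x ^+ k * y) g -> a = 0%R.
Proof.
move=> [gy]; rewrite oppr0 => gx /cdeg0.
apply: cdeg_uniq; rewrite -[a]add0r; apply: cdegMl => //.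
elim: k => [|k IH]; first by apply/cdeg0; rewrite /commute mul1g mulg1.
by rewrite expgS -[0%R]addr0; apply: cdegMl.
Qed.

End Bidegree.
End Convex.
End SlowConjugation.

(** * Supports and restrictions of series *)

Section Supports.
Variables (G : ordgroup) (K : unitRingType).
Local Open Scope ring_scope.
Local Notation D := (mn G K).
Implicit Types (f h p : D) (A B C : G -> Prop) (g : G).

Definition supp_in A f := forall g, f g != 0 -> A g.

Lemma supp_in_sub A B f : (forall g, A g -> B g) -> supp_in A f -> supp_in B f.
Proof. by move=> AB Af g /Af/AB. Qed.

Lemma supp_in_out A f g : supp_in A f -> ~ A g -> f g = 0.
Proof. by move=> Af nA; apply/eqP; apply: contrapT => /negP/Af. Qed.

Lemma supp_in0 A : supp_in A 0.
Proof. by move=> g; rewrite mn0E eqxx. Qed.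

Lemma supp_inD A f h : supp_in A f -> supp_in A h -> supp_in A (f + h).
Proof.
move=> Af Ah g; rewrite mnDE => fg; have [f0|/Af//] := eqVneq (f g) 0.
by move: fg; rewrite f0 add0r => /Ah.
Qed.

Lemma supp_inN A f : supp_in A f -> supp_in A (- f).
Proof. by move=> Af g; rewrite mnNE oppr_eq0 => /Af. Qed.

Lemma supp_inB A f h : supp_in A f -> supp_in A h -> supp_in A (f - h).
Proof. by move=> Af Ah; apply: supp_inD => //; apply: supp_inN. Qed.

Lemma supp_inM A B C f h : (forall a b, A a -> B b -> C (a * b)%g) ->
  supp_in A f -> supp_in B h -> supp_in C (f * h).
Proof. by move=> ABC Af Bh g /mn_supp_mul[a [b [/Af Aa /Bh Bb ->]]]; apply: ABC. Qed.

Lemma supp_in_grp A g : A g -> supp_in A (grp K g).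
Proof. by move=> Ag h; rewrite monoE; have [->|_] := eqVneq h g; rewrite ?eqxx. Qed.

Lemma supp_in1 A : A 1%g -> supp_in A 1.
Proof. by rewrite -(grp1 G K); apply: supp_in_grp. Qed.

Lemma restr_series A f : is_series (fun g => if `[< A g >] then f g else 0).
Proof. by apply: wo_sub (mnP f) => g; rewrite /supp; case: ifP; rewrite ?eqxx. Qed.

Definition restr A f : D := Series (@restr_series A f).

Lemma restrE A f g : restr A f g = if `[< A g >] then f g else 0.
Proof. by []. Qed.

Lemma restr_in A f g : A g -> restr A f g = f g.
Proof. by move=> Ag; rewrite restrE asboolT. Qed.

Lemma supp_restr A f : supp_in A (restr A f).
Proof. by move=> g; rewrite restrE; case: asboolP; rewrite ?eqxx. Qed.

Lemma restr_id A f : supp_in A f -> restr A f = f.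
Proof.
move=> Af; apply: mn_ext => g; rewrite restrE; case: asboolP => // nA.
by rewrite (supp_in_out Af).
Qed.

Lemma mul_restr A B C f h : supp_in A f ->
  (forall a g, A a -> (B (a^-1 * g)%g <-> C g)) -> f * restr B h = restr C (f * h).
Proof.
move=> Af ABC; apply: mn_ext => g; rewrite restrE; case: asboolP => Cg.
  by apply: mnmul_ext => a /Af Aa; rewrite restr_in //; apply/ABC.
apply/eqP; apply: contrapT => /negP/mn_supp_mul[a [b [/Af Aa /supp_restr Bb gE]]].
by apply: Cg; apply/(ABC a g Aa); rewrite gE mulKg.
Qed.

(** By [mul_restr] the part of [f^-1] in [B] is already a right inverse of [f], hence all of
    [f^-1]. *)
Lemma supp_inV A B C f : f \is a GRing.unit -> supp_in A f -> C 1%g ->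
  (forall a g, A a -> (B (a^-1 * g)%g <-> C g)) -> supp_in B f^-1.
Proof.
move=> uf Af C1 ABC; have := @mul_restr A B C f f^-1 Af ABC.
rewrite mulrV // [restr C _]restr_id; last exact: (supp_in1 C1).
by move/(congr1 (fun h => f^-1 * h)); rewrite mulKr // mulr1 => <-; apply: supp_restr.
Qed.

End Supports.

(* Moving from an element of [A] by steps [d], resp. [- d], one can leave [A] only
   through the window; it is too short to be met in both directions. *)
Lemma shift_invariant_empty (A : int -> Prop) (M : nat) (lo d : int) (w : nat) :
  (forall n, A n -> (`|n|%N <= M)%N) -> d != 0%R -> (w <= `|d|)%N ->
  (forall n : int, ~ (lo <= n < lo + w%:Z)%R -> (A n <-> A (n - d)%R)) ->
  forall n, ~ A n.
Proof.
move=> AM d0 wd Ad n An.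
pose W (k : int) := (lo <= k < lo + w%:Z)%R.
have up : exists k : nat, W (n + k.+1%:Z * d)%R.
  apply: contrapT => nW.
  have all k : A (n + k%:Z * d)%R.
    elim: k => [|k IH]; first by rewrite mul0r addr0.
    have [|_] := Ad (n + k.+1%:Z * d)%R; first by move=> Wk; apply: nW; exists k.
    apply.
    by rewrite -addn1 PoszD mulrDl mul1r addrA addrK.
  by have := AM _ (all (M + `|n| + 1)%N); nia.
have down : exists k : nat, W (n - k%:Z * d)%R.
  apply: contrapT => nW.
  have all k : A (n - k%:Z * d)%R.
    elim: k => [|k IH]; first by rewrite mul0r subr0.
    have [|+ _] := Ad (n - k%:Z * d)%R; first by move=> Wk; apply: nW; exists k.
    move/(_ IH); by rewrite -addn1 PoszD mulrDl mul1r opprD addrA.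
  by have := AM _ (all (M + `|n| + 1)%N); nia.
have [[k Wk] [k' Wk']] := (up, down); rewrite /W in Wk Wk'.
by nia.
Qed.

(** * Linear independence in the Heisenberg case *)

Section BigradedSeries.
Variables (G : ordgroup) (K : unitRingType).
Local Open Scope ring_scope.
Local Notation D := (mn G K).
Hypothesis K_skew : forall a : K, a != 0 -> a \is a GRing.unit.
(** [S a b] abstracts from [bideg]: the elements of bidegree (a, b), with the properties proved
    above. *)
Variables (S : int -> int -> G -> Prop) (x y : G).
Hypotheses (S1 : S 0 0 1%g)
  (SM : forall a b a' b' g g', S a b g -> S a' b' g' -> S (a + a') (b + b') (g * g')%g)
  (SV : forall a b g, S a b g -> S (- a) (- b) (g^-1)%g)
  (S_uniq : forall a b a' b' g, S a b g -> S a' b' g -> a = a' /\ b = b')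
  (Sx : S 1 0 x) (Sy : S 0 1 y)
  (S_center : forall g, (forall h, commute h g) -> S 0 0 g)
  (S_commute : forall k a g, S a 0 g -> commute (x ^+ k * y)%g g -> a = 0).
Variable t : letter -> G.
Hypothesis tE : forall l, t l = (x ^+ digit l * y)%g.
Implicit Types (f h p q r b : D) (g : G) (l i j : letter).

Definition xdeg n : G -> Prop := S n 0.
Definition ydeg0 g := exists n, xdeg n g.

Lemma xdegM n m g g' : xdeg n g -> xdeg m g' -> xdeg (n + m) (g * g')%g.
Proof. by move=> Hg Hg'; have := SM Hg Hg'; rewrite addr0. Qed.

Lemma xdegV n g : xdeg n g -> xdeg (- n) g^-1%g.
Proof. by move=> /SV; rewrite oppr0. Qed.

Lemma xdeg_uniq n m g : xdeg n g -> xdeg m g -> n = m.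
Proof. by move=> Hn Hm; case: (S_uniq Hn Hm). Qed.

Lemma xdegX k : xdeg k%:Z (x ^+ k)%g.
Proof. by elim: k => [|k IH]; rewrite ?expgS -1?add1n ?PoszD; [exact: S1|exact: xdegM]. Qed.

Lemma xdeg_div n m a g : xdeg n a -> xdeg m (a^-1 * g)%g <-> xdeg (n + m) g.
Proof.
move=> Ha; split=> Hg; first by rewrite -[g](mulVKg a); apply: xdegM.
by rewrite -[m](addKr n); apply: xdegM Hg; apply: xdegV.
Qed.

(** Laurent polynomials in [x] over the series supported in [S 0 0]: finitely many x-degrees occur,
    and each component is an arbitrary series. *)
Definition poly p := exists s : seq int, supp_in (fun g => exists2 n, n \in s & xdeg n g) p.

Lemma poly_xdeg n p : supp_in (xdeg n) p -> poly p.
Proof. by move=> Hp; exists [:: n] => g /Hp; exists n; rewrite ?inE. Qed.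

Lemma poly0 : poly 0.
Proof. by apply: (@poly_xdeg 0); apply: supp_in0. Qed.

Lemma poly1 : poly 1.
Proof. by apply: (@poly_xdeg 0); apply: supp_in1. Qed.

Lemma polyD p q : poly p -> poly q -> poly (p + q).
Proof.
move=> [s sp] [s' sq]; exists (s ++ s'); apply: supp_inD.
  by apply: supp_in_sub sp => g [n ns ?]; exists n; rewrite ?mem_cat ?ns.
by apply: supp_in_sub sq => g [n ns ?]; exists n; rewrite ?mem_cat ?ns ?orbT.
Qed.

Lemma polyN p : poly p -> poly (- p).
Proof. by move=> [s sp]; exists s; apply: supp_inN. Qed.

Lemma polyB p q : poly p -> poly q -> poly (p - q).
Proof. by move=> ? ?; apply/polyD/polyN. Qed.

Lemma polyM p q : poly p -> poly q -> poly (p * q).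
Proof.
move=> [s sp] [s' sq]; exists [seq n + m | n <- s, m <- s'].
apply: supp_inM sp sq => a b [n ns Ha] [m ms Hb]; exists (n + m); last exact: xdegM.
by apply/allpairsP; exists (n, m).
Qed.

Lemma poly_ydeg0 p : poly p -> supp_in ydeg0 p.
Proof. by move=> [s sp] g /sp[n _]; exists n. Qed.

Definition comp n f := restr (xdeg n) f.

Lemma mul_comp n m f h g : supp_in (xdeg n) f -> xdeg (n + m) g -> (f * h) g = (f * comp m h) g.
Proof.
move=> Hf Hg; apply: mnmul_ext => a /Hf Ha; rewrite restr_in //.
exact/(xdeg_div _ _ Ha).
Qed.

Lemma supp_mul_xdeg n m f h : supp_in (xdeg n) f -> supp_in (xdeg m) h -> supp_in (xdeg (n + m)) (f * h).
Proof. by apply: supp_inM => a b; apply: xdegM. Qed.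

Lemma supp_inv_xdeg n f : f != 0 -> supp_in (xdeg n) f -> supp_in (xdeg (- n)) f^-1.
Proof.
move=> f0 Hf; apply: (supp_inV (C := xdeg 0)) Hf _ _; rewrite ?mn_skew //.
by move=> a g Ha; have := @xdeg_div n (- n) a g Ha; rewrite addrN.
Qed.

Definition polyR N p := supp_in (fun g => exists2 a : nat, (a < N)%N & xdeg a g) p.

Lemma polyR_lower N p : polyR N.+1 p -> comp N p = 0 -> polyR N p.
Proof.
move=> pN c0 g pg; have [a aN Ha] := pN g pg; exists a => //.
rewrite ltn_neqAle -ltnS aN andbT; apply: contra_neq pg => aE.
by rewrite -(restr_in p Ha) aE -/(comp _ _) c0.
Qed.

Lemma polyR0 p : polyR 0 p -> p = 0.
Proof. by move=> p0; apply/eqP; apply: contrapT => /negP/mn_neq0[g /p0[]]. Qed.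

(** One division step: the quotient of the top components is homogeneous of degree [M - N], since
    homogeneous series have homogeneous inverses. *)
Lemma polyR_sub_top M N r p : (N <= M)%N -> polyR M.+1 r -> polyR N.+1 p -> comp N p != 0 ->
  exists c, [/\ poly c, comp M r != 0 -> c != 0 & polyR M (r - c * p)].
Proof.
move=> NM rM pN pt; pose c := comp M r * (comp N p)^-1.
have Hc : supp_in (xdeg (M%:Z - N%:Z)) c.
  by apply: supp_mul_xdeg; [apply: supp_restr|apply: supp_inv_xdeg => //; apply: supp_restr].
exists c; split; first exact: poly_xdeg Hc.
  apply: contra_neq => c0.
  by rewrite -[LHS](mulrVK (mn_skew K_skew pt)) -/c c0 mul0r.
apply: polyR_lower.
  apply: supp_inB => //; apply: supp_inM Hc pN => a b Ha [k kN Hb].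
  exists (M - N + k)%N; first by lia.
  by rewrite PoszD -subzn //; apply: xdegM.
apply: mn_ext => g; rewrite restrE mn0E; case: asboolP => // Hg.
rewrite mnBE (mul_comp (m := N) _ Hc) ?subrK //.
by rewrite /c mulrVK ?mn_skew // restr_in // subrr.
Qed.

(* The left Ore condition, by the Euclidean algorithm. *)
Lemma polyR_ore L M N r p : (M + N <= L)%N -> polyR M r -> polyR N p -> p != 0 ->
  exists q s, [/\ poly q, poly s, q != 0 & q * r = s * p].
Proof.
elim: L M N r p => [|L IH] M N r p MNL rM pN p0.
  by move: pN; rewrite (_ : N = 0%N); [move/polyR0 => pE; rewrite pE eqxx in p0|lia].
case: N pN MNL => [/polyR0 pE|N pN MNL]; first by rewrite pE eqxx in p0.
have [pt|pt] := eqVneq (comp N p) 0.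
  by apply: (IH M N) => //; [lia|apply: polyR_lower].
case: M rM MNL => [/polyR0 rE MNL|M rM MNL].
  by exists 1, 0; rewrite rE mulr0 mul0r oner_neq0; split; [apply: poly1|apply: poly0| |].
have [rt|rt] := eqVneq (comp M r) 0.
  by apply: (IH M N.+1) => //; apply: polyR_lower.
have [NM|MN] := leqP N M.
  have [c [cp _ r'M]] := polyR_sub_top NM rM pN pt.
  have [|q [s [qp sp q0 qs]]] := IH M N.+1 _ p _ r'M pN p0; first by lia.
  exists q, (s + q * c); split=> //; first by apply/polyD/polyM.
  by rewrite mulrDl -mulrA -qs mulrBr subrK.
have [c [cp c0 p'N]] := polyR_sub_top (ltnW MN) pN rM rt.
have {}c0 := c0 pt.
(* If the remainder vanishes, [c * r = p] itself is the relation, and [c] is nonzero since the top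
   component of [p] is. *)
have [p'0|p'0] := eqVneq (p - c * r) 0.
  exists c, 1; split=> //; first exact: poly1.
  by rewrite mul1r; apply/esym/eqP; rewrite -subr_eq0 p'0.
have [|q [s [qp sp q0 qs]]] := IH M.+1 N r _ _ rM p'N p'0; first by lia.
exists (q + s * c), s; split=> //; first by apply/polyD/polyM.
  apply/eqP => qsc; have : s * p = 0.
    by have : (q + s * c) * r = 0 by [rewrite qsc mul0r];
       rewrite mulrDl qs mulrBr -mulrA subrK.
  case/mn_mul_eq0 => // [s0|pE]; last by rewrite pE eqxx in p0.
  by move: qsc; rewrite s0 mul0r addr0 => qE; rewrite qE eqxx in q0.
by rewrite mulrDl qs mulrBr -mulrA subrK.
Qed.

Lemma poly_shift p : poly p -> exists k N, polyR N (grp K (x ^+ k)%g * p).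
Proof.
move=> [s sp]; pose k := \max_(n <- s) `|n|%N; exists k, (2 * k).+1.
have Hx : supp_in (xdeg k) (grp K (x ^+ k)%g) by exact: supp_in_grp (xdegX k).
apply: supp_inM Hx sp => a b Ha [n ns Hb].
have nk : (`|n| <= k)%N by rewrite /k (big_rem n) //= leq_maxl.
exists (absz (k%:Z + n)); first by lia.
by rewrite (_ : Posz (absz (k%:Z + n)) = k%:Z + n); [apply: xdegM|lia].
Qed.

Lemma poly_grp n g : xdeg n g -> poly (grp K g).
Proof. by move=> Hg; apply: (@poly_xdeg n); apply: supp_in_grp. Qed.

Lemma poly_ore r p : poly r -> poly p -> p != 0 ->
  exists q s, [/\ poly q, poly s, q != 0 & q * r = s * p].
Proof.
move=> /poly_shift[k [M rM]] /poly_shift[k' [N pN]] p0.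
have px (d : nat) : poly (grp K (x ^+ d)%g) by apply/poly_grp/xdegX.
have [|q [s [qp sp q0 qs]]] := @polyR_ore _ M N _ _ (leqnn _) rM pN.
- by rewrite -(mulr0 (grp K (x ^+ k')%g)) (inj_eq (mulrI (grp_unit K _))).
exists (q * grp K (x ^+ k)%g), (s * grp K (x ^+ k')%g).
split; [exact: polyM|exact: polyM| |by rewrite -!mulrA].
by rewrite -(mul0r (grp K (x ^+ k)%g)) (inj_eq (mulIr (grp_unit K _))).
Qed.

(** The field F of left fractions: [f] is [p^-1 * (p * f)] with denominator [p]. *)
Definition frac f := supp_in ydeg0 f /\ exists p, [/\ poly p, p != 0 & poly (p * f)].

Lemma poly_frac p : poly p -> frac p.
Proof.
move=> pp; split; first exact: poly_ydeg0.
by exists 1; rewrite mul1r oner_neq0; split=> //; apply: poly1.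
Qed.

Lemma mn_mul_neq0 f h : f != 0 -> h != 0 -> f * h != 0.
Proof. by move=> /eqP f0 /eqP h0; apply/eqP => /(mn_mul_eq0 K_skew)[]. Qed.

Lemma fracD f h : frac f -> frac h -> frac (f + h).
Proof.
move=> [Gf [p [pp p0 pf]]] [Gh [q [pq q0 qh]]]; split; first exact: supp_inD.
have [u [v [pu pv u0 uv]]] := poly_ore pp pq q0.
exists (u * p); split; [exact: polyM|exact: mn_mul_neq0|].
rewrite mulrDr {2}uv -!mulrA; apply: polyD; exact: polyM.
Qed.

Lemma fracN f : frac f -> frac (- f).
Proof.
move=> [Gf [p [pp p0 pf]]]; split; first exact: supp_inN.
by exists p; split=> //; rewrite mulrN; apply: polyN.
Qed.

Lemma fracB f h : frac f -> frac h -> frac (f - h).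
Proof. by move=> ? ?; apply/fracD/fracN. Qed.

(** The Ore condition moves the numerator [p * f] past the denominator [q] of [h]. *)
Lemma fracM f h : frac f -> frac h -> frac (f * h).
Proof.
move=> [Gf [p [pp p0 pf]]] [Gh [q [pq q0 qh]]]; split.
  by apply: supp_inM Gf Gh => a b [n Ha] [m Hb]; exists (n + m); apply: xdegM.
have [u [v [pu pv u0 uv]]] := poly_ore pf pq q0.
exists (u * p); split; [exact: polyM|exact: mn_mul_neq0|].
by rewrite -mulrA [p * _]mulrA mulrA uv -mulrA; apply: polyM.
Qed.

Lemma fracV f : f != 0 -> frac f -> frac f^-1.
Proof.
move=> f0 [Gf [p [pp p0 pf]]]; split.
  apply: (supp_inV (C := ydeg0)) Gf _ _; rewrite ?mn_skew //; first by exists 0.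
  move=> a g [n Ha]; split=> -[m Hm].
    by exists (n + m); apply/(xdeg_div _ _ Ha).
  by exists (- n + m); apply/(xdeg_div _ _ Ha); rewrite addNKr.
by exists (p * f); rewrite mulrK ?mn_skew // mn_mul_neq0.
Qed.

(** The effect of [t l] on a left coefficient: [t_l f v = (twist l i f) t_i v]. *)
Definition twist l i f := grp K (t l) * f * (grp K (t i))^-1.

Lemma St l : S (digit l)%:Z 1 (t l).
Proof. by have := SM (xdegX (digit l)) Sy; rewrite addr0 add0r tE. Qed.

Lemma twistE l i f g : twist l i f g = f ((t l)^-1 * g * t i)%g.
Proof. by rewrite /twist -grpV mul_to_grp mul_grp invgK mulgA. Qed.

Lemma twistM l i f h : twist l i (f * h) = twist l l f * twist l i h.
Proof. by rewrite /twist !mulrA mulrVK ?grp_unit. Qed.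

Definition shift l i : int := (digit l)%:Z - (digit i)%:Z.

Lemma xdeg_twist l i n g : xdeg n ((t l)^-1 * g * t i)%g <-> xdeg (n + shift l i) g.
Proof.
split=> Hg.
  have -> : g = (t l * ((t l)^-1 * g * t i) * (t i)^-1)%g by rewrite !mulgA mulgV mul1g mulgK.
  have := SM (SM (St l) Hg) (SV (St i)).
  rewrite addr0 subrr (_ : _ + n - _ = n + shift l i) //.
  by rewrite /shift; lia.
have := SM (SM (SV (St l)) Hg) (St i).
rewrite addr0 addNr (_ : - _ + (n + _) + _ = n) //.
by rewrite /shift; lia.
Qed.

Lemma poly_twist l i p : poly p -> poly (twist l i p).
Proof.
move=> [s sp]; exists [seq n + shift l i | n <- s] => g; rewrite twistE => /sp[n ns Hn].
by exists (n + shift l i); [apply: map_f|apply/xdeg_twist].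
Qed.

Lemma twist_eq0 l i f : (twist l i f == 0) = (f == 0).
Proof.
apply/eqP/eqP => [|->]; last by rewrite /twist mulr0 mul0r.
move/(congr1 (fun h => (grp K (t l))^-1 * h * grp K (t i))).
by rewrite mulr0 mul0r /twist !mulrA mulVr ?grp_unit // mul1r mulrVK ?grp_unit.
Qed.

Lemma frac_twist l i f : frac f -> frac (twist l i f).
Proof.
move=> [Gf [p [pp p0 pf]]]; split.
  by move=> g; rewrite twistE => /Gf[n /xdeg_twist]; exists (n + shift l i).
exists (twist l l p); rewrite twist_eq0 -twistM.
by split=> //; apply: poly_twist.
Qed.

Lemma twist_commute_supp l f : supp_in ydeg0 f -> twist l l f = f -> supp_in (xdeg 0) f.
Proof.
move=> Gf fE g fg; have [n Hn] := Gf g fg; rewrite -(S_commute Hn (k := digit l)) //.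
rewrite -tE; apply: commute_supp fg; rewrite -{1}fE /twist.
by rewrite mulrVK ?grp_unit.
Qed.

(* A minimal annihilator [p] of [b] modulo [poly], normalised to have constant
   component 1, commutes with [t l]; hence [p = 1]. *)
Lemma frac_twist_poly l i b r : frac b -> poly r -> twist l i b - b = r -> poly b.
Proof.
move=> [_ [p [pp p0 pb]]] pr br.
have {pp} [s sp] := pp; have [N] := ubnP (size s).
elim: N => // N IH in s p p0 pb sp *; case: s sp => [|n s] sp szs.
  by have [g pg] := mn_neq0 p0; have [] := sp g pg.
have [pn0|pn0] := eqVneq (comp n p) 0.
  apply: (IH s p) => // g pg; have [k] := sp g pg; rewrite inE => /orP[/eqP ->|ks] Hg.
    by move: pg; rewrite -(restr_in p Hg) -/(comp _ _) pn0 eqxx.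
  by exists k.
pose u := (comp n p)^-1; pose p' := u * p.
have Hu : supp_in (xdeg (- n)) u by apply: supp_inv_xdeg => //; apply: supp_restr.
have p'b : poly (p' * b) by rewrite -mulrA; apply: polyM => //; apply: poly_xdeg Hu.
have p'0 g : xdeg 0 g -> p' g = (1 : D) g.
  move=> Hg; rewrite /p' (mul_comp (m := n) _ Hu) ?addNr //.
  by rewrite /u mulVr ?mn_skew.
have p's : supp_in (fun g => exists2 k, k \in [seq k - n | k <- n :: s] & xdeg k g) p'.
  apply: supp_inM Hu sp => a c Ha [k ks Hc]; exists (k - n); first by apply/mapP; exists k.
  by rewrite addrC; apply: xdegM.
(* As [twist l i (p' * b) = twist l l p' * (b + r)], the product [q * b] is again a Laurent
   polynomial. The constant components cancel, so fewer degrees remain. *)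
pose q := twist l l p' - p'.
have qs : supp_in (fun g => exists2 k, k \in [seq k - n | k <- s] & xdeg k g) q.
  move=> g qg.
  have [k ks Hk] : exists2 k, k \in [seq k - n | k <- n :: s] & xdeg k g.
    have [p'g|] := eqVneq (p' g) 0; last exact: p's.
    move: qg; rewrite mnBE p'g subr0 twistE => /p's[k ks /xdeg_twist].
    by rewrite /shift subrr addr0; exists k.
  move: ks Hk; rewrite /= inE subrr => /orP[/eqP -> Hg|ks Hg]; last by exists k.
  move: qg; rewrite mnBE twistE !p'0 //; last by apply/xdeg_twist; rewrite /shift subrr.
  rewrite !mn1E (_ : (_ == 1%g) = (g == 1%g)) ?subrr ?eqxx //.
  apply/eqP/eqP => [|->]; last by rewrite mulg1 mulVg.
  by move/(congr1 (fun z => t l * z * (t l)^-1)%g); rewrite !mulgA mulgV mul1g mulgK mulg1 mulgV.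
have qb : poly (q * b).
  rewrite mulrBl; apply: polyB => //.
  have -> : twist l l p' * b = twist l i (p' * b) - twist l l p' * r.
    by rewrite (twistM l i p' b) -br mulrBr opprB addrC subrK.
  apply: polyB; first exact: poly_twist.
  apply: polyM => //; apply: poly_twist; apply: polyM; first exact: poly_xdeg Hu.
  by exists (n :: s).
have [q0|q0] := eqVneq q 0; last by apply: (IH _ q q0 qb qs); rewrite size_map.
have p'1 : p' = 1.
  have Hp' : supp_in (xdeg 0) p'.
    apply: (@twist_commute_supp l); last by apply/eqP; rewrite -subr_eq0 -/q q0.
    by move=> g /p's[k _ Hk]; exists k.
  apply: mn_ext => g; have [/p'0//|nH] := pselect (xdeg 0 g).
  by rewrite (supp_in_out Hp' nH) mn1E; case: eqP nH => // ->.
by rewrite p'1 mul1r in p'b.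
Qed.

(** The x-degrees of [b] are bounded and, outside the window, invariant under [shift l i], so
    [shift_invariant_empty] applies. *)
Lemma twist_window l i b (lo : int) (w : nat) : poly b -> shift l i != 0 ->
  (w <= `|shift l i|)%N ->
  (forall n g, ~ (lo <= n < lo + w%:Z) -> xdeg n g -> (twist l i b - b) g = 0) -> b = 0.
Proof.
move=> [s sb] d0 wd wb; apply/eqP; apply: contrapT => /negP/mn_neq0[g bg].
pose A n := exists2 g, xdeg n g & b g != 0.
have [n ns Hg] := sb g bg.
apply: (@shift_invariant_empty A (\max_(n <- s) `|n|%N) lo (shift l i) w _ d0 wd _ n).
- move=> m [h Hh bh]; have [k ks Hk] := sb h bh; rewrite (xdeg_uniq Hh Hk).
  by rewrite (big_rem k) //= leq_maxl.
- move=> m nW; split=> -[h Hh bh].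
    have Hm : xdeg (m - shift l i + shift l i) h by rewrite subrK.
    exists ((t l)^-1 * h * t i)%g; first exact/xdeg_twist.
    by rewrite -twistE; have /eqP := wb m h nW Hh; rewrite mnBE subr_eq0 => /eqP ->.
  have hE : ((t l)^-1 * (t l * h * (t i)^-1) * t i)%g = h by rewrite -!mulgA mulVg mulg1 mulKg.
  have Hm : xdeg m (t l * h * (t i)^-1)%g.
    by rewrite -[m](subrK (shift l i)); apply/xdeg_twist; rewrite hE.
  exists (t l * h * (t i)^-1)%g => //.
  have /eqP := wb m _ nW Hm; rewrite mnBE subr_eq0 => /eqP <-.
  by rewrite twistE hE.
by exists g.
Qed.

Lemma frac_twist_fixed l i b : i != l -> frac b -> twist l i b = b -> b = 0.
Proof.
move=> il fb bE.
have pb : poly b.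
  by apply: (frac_twist_poly (l := l) (i := i) fb poly0); rewrite bE subrr.
apply: (@twist_window l i b 0 0) => //; last by move=> n g _ _; rewrite bE subrr.
rewrite /shift subr_eq0; apply/eqP => -[/digit_inj li]; by rewrite li eqxx in il.
Qed.

(** This is 1 minus [x] or its inverse; in [ev_vec] it is the coefficient of [vec (i :: w)]. *)
Definition coef i : D := 1 - grp K (t (linv i) * (t i)^-1)%g.

Lemma xdeg_coef i : xdeg (shift (linv i) i) (t (linv i) * (t i)^-1)%g.
Proof. by have := SM (St (linv i)) (SV (St i)); rewrite subrr. Qed.

Lemma poly_coef i : poly (coef i).
Proof. by apply: polyB; [exact: poly1|exact: poly_grp (xdeg_coef i)]. Qed.

Lemma coef_1 i : coef i 1%g = 1.
Proof.
rewrite mnBE mn1E eqxx monoE eq_sym; case: eqP => [tt|_]; last by rewrite subr0.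
have := xdeg_coef i; rewrite tt => /(xdeg_uniq S1).
by case: i {tt} => [] [] [].
Qed.

(** For [i = l] the two sides differ at the identity of the group. Otherwise the shift is at least 2
    in absolute value while [coef i] lives in two consecutive degrees, so [twist_window] gives
    [b = 0]. *)
Lemma no_twist_coef l i b : i != linv l -> frac b -> twist l i b - b <> coef i.
Proof.
move=> il fb bE.
have pb := frac_twist_poly fb (poly_coef i) bE.
have [li|li] := eqVneq i l.
  have /eqP := coef_1 i; rewrite -bE mnBE twistE li mulg1 mulVg subrr eq_sym.
  by rewrite oner_eq0.
have [lo lowin] : exists lo : int, forall n g, ~ (lo <= n < lo + 2%:Z) -> xdeg n g -> coef i g = 0.
  exists (Num.min 0 (shift (linv i) i)) => n g nW Hg.
  rewrite mnBE mn1E monoE; case: eqP => [g1|_].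
    by case: nW; rewrite g1 in Hg; rewrite (xdeg_uniq Hg S1); case: (i) => [] [] [].
  case: eqP => [gE|_]; last by rewrite subr0.
  case: nW; rewrite gE in Hg; rewrite (xdeg_uniq Hg (xdeg_coef i)).
  by case: (i) => [] [] [].
have b0 : b = 0.
  apply: (@twist_window l i b lo 2) => //.
  - by case: (l) (i) il li => [] [] [] [[] []].
  - by case: (l) (i) il li => [] [] [] [[] []].
  by move=> n g nW Hg; rewrite bE; apply: lowin Hg.
by have /eqP := coef_1 i; rewrite -bE b0 /twist mulr0 mul0r subrr mn0E eq_sym oner_eq0.
Qed.

Definition finite_ydeg f :=
  exists s : seq int, supp_in (fun g => exists2 m, m \in s & exists n, S n m g) f.

Lemma finite_ydegD f h : finite_ydeg f -> finite_ydeg h -> finite_ydeg (f + h).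
Proof.
move=> [s sf] [s' sh]; exists (s ++ s'); apply: supp_inD.
  by apply: supp_in_sub sf => g [n ns ?]; exists n; rewrite ?mem_cat ?ns.
by apply: supp_in_sub sh => g [n ns ?]; exists n; rewrite ?mem_cat ?ns ?orbT.
Qed.

Lemma finite_ydegM f h : supp_in ydeg0 f -> finite_ydeg h -> finite_ydeg (f * h).
Proof.
move=> Gf [s sh]; exists s; apply: supp_inM Gf sh => a b [n Ha] [m ms [k Hb]].
by exists m => //; exists (n + k); rewrite -[m]add0r; apply: SM.
Qed.

Lemma finite_ydeg1 : finite_ydeg 1.
Proof. by exists [:: 0]; apply: supp_in1; exists 0; rewrite ?inE //; exists 0. Qed.

Lemma finite_ydegt l f : finite_ydeg f -> finite_ydeg (grp K (t l) * f).
Proof.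
move=> [s sf]; exists [seq 1 + m | m <- s].
have Ht : supp_in (S (digit l)%:Z 1) (grp K (t l)) by exact: supp_in_grp (St l).
apply: supp_inM Ht sf => a b Ha [m ms [k Hb]].
by exists (1 + m); [apply: map_f|exists ((digit l)%:Z + k); apply: SM].
Qed.

(** The y-degrees of such an [f] would be invariant under the shift by 1 except at 0, impossible for
    a bounded nonempty set. *)
Lemma no_finite_ydeg_inverse l f : finite_ydeg f -> f - grp K (t l) * f <> 1.
Proof.
move=> [s sf] fE.
have f0 : f != 0 by apply/eqP => f0; move/eqP: fE; rewrite f0 mulr0 subrr eq_sym oner_eq0.
have [g fg] := mn_neq0 f0; have [m ms [n Hg]] := sf g fg.
pose A m := exists2 g, (exists n, S n m g) & f g != 0.
apply: (@shift_invariant_empty A (\max_(n <- s) `|n|%N) 0 1 1 _ _ _ _ m) => //.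
- move=> k [h [n' Hh] fh]; have [k' ks [n'' Hh']] := sf h fh.
  by rewrite (S_uniq Hh Hh').2 (big_rem k') //= leq_maxl.
- move=> k k0.
  have fS (z : G) : (exists n, S n k z) -> f z = f ((t l)^-1 * z)%g.
    move=> [n' Hz]; apply/eqP; rewrite -mul_grp -subr_eq0 -mnBE fE mn1E.
    have [z1|_] := eqVneq z 1%g; last by rewrite eqxx.
    by case: k0; rewrite z1 in Hz; rewrite (S_uniq Hz S1).2.
  split=> -[h [n' Hh] fh].
    exists ((t l)^-1 * h)%g; last by rewrite -fS //; exists n'.
    exists (- (digit l)%:Z + n'); rewrite [k - 1]addrC; exact: SM (SV (St l)) Hh.
  exists (t l * h)%g; last by rewrite fS ?mulKg //; exists ((digit l)%:Z + n');
    rewrite -[k](subrK 1) [_ + 1]addrC; exact: SM (St l) Hh.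
  exists ((digit l)%:Z + n'); rewrite -[k](subrK 1) [_ + 1]addrC; exact: SM (St l) Hh.
by exists g => //; exists n.
Qed.

Lemma t_neq1 l : t l <> 1%g.
Proof. by move=> tl; have := St l; rewrite tl => /(S_uniq S1)[]. Qed.

(** * Words as vectors over F, filtered by length *)

Let E := ev K t.

(** [E (l :: w)] without its factor [1 - t (linv l)]; on this vector [t l] acts by subtracting
    [E w]. The value 0 at the empty word is a default. *)
Definition vec (w : word bool) : D :=
  if w is l :: w' then (1 - grp K (t l))^-1 * E w' else 0.

Let ohd (w : word bool) : letter := head (false, false) w.

Lemma t_vec l w : grp K (t l) * vec (l :: w) = vec (l :: w) - E w.
Proof.
have <- : (1 - grp K (t l)) * vec (l :: w) = E w.
  by rewrite mulrA mulrV ?mul1r // sub_unit //; apply: t_neq1.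
by rewrite mulrBl mul1r opprB addrC subrK.
Qed.

Lemma ev_vec i w : E (i :: w) = coef i * vec (i :: w) + (1 - coef i) * E w.
Proof.
have -> : 1 - coef i = grp K (t (linv i)) * (grp K (t i))^-1.
  by rewrite opprB addrC subrK grpM grpV.
have Ew : E w = vec (i :: w) - grp K (t i) * vec (i :: w).
  by rewrite t_vec opprB addrC subrK.
rewrite [in RHS]Ew mulrBr -[_ * _ * (_ * vec _)]mulrA mulKr ?grp_unit //.
rewrite /coef grpM grpV mulrBl mul1r addrA subrK.
by rewrite /E ev_cons /gen -mulrA -/(vec (i :: w)) mulrBl mul1r.
Qed.

Lemma t_mul_vec l i w f :
  grp K (t l) * (f * vec (i :: w)) = twist l i f * vec (i :: w) - twist l i f * E w.
Proof. by rewrite -mulrBr -t_vec /twist !mulrA mulrVK ?grp_unit. Qed.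

Definition words n : seq (word bool) := [seq w <- [seq val u | u : n.-tuple letter] | redb w].

Lemma mem_words n w : (w \in words n) = redb w && (size w == n).
Proof.
rewrite mem_filter; congr (_ && _); apply/mapP/eqP => [[u _ ->]|wn]; first exact: size_tuple.
by case: n / wn; exists (in_tuple w); rewrite ?mem_enum.
Qed.

Lemma uniq_words n : uniq (words n).
Proof. by rewrite filter_uniq // map_inj_uniq ?enum_uniq //; apply: val_inj. Qed.

Lemma sum_words_cons l n (F : word bool -> D) :
  \sum_(w <- words n.+1 | ohd w == l) F w = \sum_(u <- words n | redb (l :: u)) F (l :: u).
Proof.
rewrite -big_filter -[RHS]big_filter -(big_map (cons l) xpredT).
apply/perm_big/uniq_perm; first exact/filter_uniq/uniq_words.
  by rewrite map_inj_uniq; [apply/filter_uniq/uniq_words|move=> u v []].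
move=> w; rewrite mem_filter mem_words; apply/idP/mapP => [|[u + ->]].
  case: w => [|k w]; first by rewrite andbF.
  move=> /andP[/eqP/= kl /andP[rw /eqP[wn]]]; exists w; last by rewrite -kl.
  by rewrite mem_filter -kl rw mem_words wn eqxx andbT; apply: path_sorted rw.
by rewrite mem_filter mem_words /= eqxx eqSS => /andP[-> /andP[_ ->]].
Qed.

(** The left F-span of the [vec w] of length at most [n], modulo series with finitely many
    y-degrees; the longest vectors are split off first. *)
Fixpoint span n f : Prop :=
  if n is n'.+1 then
    exists a : word bool -> D, (forall w, frac (a w)) /\
      span n' (f - \sum_(w <- words n'.+1) a w * vec w)
  else finite_ydeg f.

Lemma frac0 : frac 0.
Proof. exact/poly_frac/poly0. Qed.

Lemma span0 n : span n 0.
Proof.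
elim: n => [|n IH]; first by exists [::]; apply: supp_in0.
exists (fun _ => 0); split=> [w|]; first exact: frac0.
by rewrite big1 ?subr0 // => w _; rewrite mul0r.
Qed.

Lemma spanD n f h : span n f -> span n h -> span n (f + h).
Proof.
elim: n f h => [|n IH] f h; first exact: finite_ydegD.
move=> [a [Fa Sa]] [b [Fb Sb]]; exists (fun w => a w + b w); split=> [w|]; first exact: fracD.
under eq_bigr do rewrite mulrDl.
by rewrite big_split opprD addrACA; apply: IH.
Qed.

Lemma spanM n f h : frac f -> span n h -> span n (f * h).
Proof.
move=> Ff; elim: n h => [|n IH] h; first by apply: finite_ydegM; case: Ff.
move=> [a [Fa Sa]]; exists (fun w => f * a w); split=> [w|]; first exact: fracM.
under eq_bigr do rewrite -mulrA.
by rewrite -mulr_sumr -mulrBr; apply: IH.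
Qed.

Lemma frac1 : frac 1.
Proof. exact/poly_frac/poly1. Qed.

Lemma spanN n f : span n f -> span n (- f).
Proof. by move=> Sf; rewrite -mulN1r; apply: spanM => //; apply/fracN/frac1. Qed.

Lemma spanB n f h : span n f -> span n h -> span n (f - h).
Proof. by move=> ? ?; apply/spanD/spanN. Qed.

Lemma span_sum n (I : Type) (s : seq I) (P : pred I) (F : I -> D) :
  (forall k, P k -> span n (F k)) -> span n (\sum_(k <- s | P k) F k).
Proof.
move=> SF; elim/big_rec: _ => [|k f Pk Sf]; first exact: span0.
by apply: spanD => //; apply: SF.
Qed.

Lemma span_S n f : span n f -> span n.+1 f.
Proof.
move=> Sf; exists (fun _ => 0); split=> [w|]; first exact: frac0.
by rewrite big1 ?subr0 // => w _; rewrite mul0r.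
Qed.

Lemma span_le m n f : (m <= n)%N -> span m f -> span n f.
Proof.
move=> /subnKC <-; elim: (n - m)%N => [|k IH] Sf; first by rewrite addn0.
by rewrite addnS; apply/span_S/IH.
Qed.

Lemma span_combination n (a : word bool -> D) : (forall w, frac (a w)) ->
  span n (\sum_(w <- words n) a w * vec w).
Proof.
case: n => [|n] Fa; last by exists a; split=> //; rewrite subrr; apply: span0.
rewrite big_seq big1; first exact: (span0 0).
by move=> w; rewrite mem_words => /andP[_ /eqP/size0nil ->]; rewrite mulr0.
Qed.

Lemma span_vec w : redb w -> span (size w) (vec w).
Proof.
move=> rw; have [w0|wn] := posnP (size w).
  by rewrite (size0nil w0); apply: (span0 0).
have -> : vec w = \sum_(u <- words (size w)) (if u == w then 1 else 0) * vec u.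
  rewrite (bigD1_seq w) ?uniq_words ?mem_words ?rw ?eqxx //= mul1r big1 ?addr0 //.
  by move=> u /negPf ->; rewrite mul0r.
by apply: span_combination => u; case: ifP => _; [apply: frac1|apply: frac0].
Qed.

Lemma span_ev w : redb w -> span (size w) (E w).
Proof.
elim: w => [|i w IH] rw; first exact: finite_ydeg1.
rewrite ev_vec; apply: spanD.
  by apply: spanM; [apply/poly_frac/poly_coef|apply: span_vec rw].
apply/span_S/spanM; last exact/IH/(path_sorted rw).
by apply: fracB; [apply: frac1|apply/poly_frac/poly_coef].
Qed.

(** Modulo shorter words, passing from a word to its vector only brings in the factor [coef i]. *)
Lemma span_ev_vec i w : redb (i :: w) -> span (size w) (E (i :: w) - coef i * vec (i :: w)).
Proof.
move=> rw; rewrite ev_vec addrC addKr; apply: spanM; last exact/span_ev/(path_sorted rw).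
by apply: fracB; [apply: frac1|apply/poly_frac/poly_coef].
Qed.

Lemma words_cons n w : w \in words n.+1 ->
  [/\ w = ohd w :: behead w, redb (behead w) & size (behead w) = n].
Proof.
case: w => [|i w]; rewrite mem_words => /andP[rw /eqP] //= -[wn].
by split=> //; apply: path_sorted rw.
Qed.

Lemma t_combination l n (a : word bool -> D) :
  grp K (t l) * \sum_(w <- words n.+1) a w * vec w =
  \sum_(w <- words n.+1) twist l (ohd w) (a w) * vec w -
  \sum_(w <- words n.+1) twist l (ohd w) (a w) * E (behead w).
Proof.
rewrite mulr_sumr -sumrB; rewrite [LHS]big_seq [RHS]big_seq; apply: eq_bigr => w /words_cons[wE _ _].
by rewrite {1 2 3}wE t_mul_vec -wE.
Qed.

Lemma span_tails l n (a : word bool -> D) : (forall w, frac (a w)) ->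
  span n (\sum_(w <- words n.+1) twist l (ohd w) (a w) * E (behead w)).
Proof.
move=> Fa; rewrite big_seq; apply: span_sum => w /words_cons[_ rw <-].
by apply: spanM; [apply: frac_twist|apply: span_ev].
Qed.

Lemma span_t l n f : span n f -> span n (grp K (t l) * f).
Proof.
elim: n f => [|n IH] f; first exact: finite_ydegt.
move=> [a [Fa Sa]]; rewrite -[f](subrK (\sum_(w <- words n.+1) a w * vec w)) mulrDr.
apply: spanD; first exact/span_S/IH.
rewrite t_combination; apply: spanB; last exact/span_S/span_tails.
by apply: span_combination => w; apply: frac_twist.
Qed.

Lemma count_lt (T : eqType) (P Q : pred T) (s : seq T) (u : T) :
  (forall v, P v -> Q v) -> u \in s -> Q u -> ~~ P u -> (count P s < count Q s)%N.
Proof.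
move=> PQ + Qu Pu; elim: s => // v s IH; rewrite inE => /orP[/eqP <-|us] /=.
  by rewrite Qu (negPf Pu) ltnS sub_count.
rewrite -addnS leq_add ?IH //.
by case Pv: (P v); rewrite // (PQ _ Pv).
Qed.

Section MinimalRelation.
Variable n : nat.
Let W := words n.+1.
Let rel (a : word bool -> D) :=
  (forall w, frac (a w)) /\ span n (\sum_(w <- W) a w * vec w).

Let tail_sum l (a : word bool -> D) :=
  \sum_(u <- words n | redb (l :: u)) a (l :: u) * E u.

(* Subtracting from a relation its multiple by [t l] kills one coefficient, so the
   coefficients of a relation with the fewest terms are fixed by [twist]. *)
Lemma minimal_relation a w0 : rel a -> w0 \in W -> a w0 != 0 ->
  exists (b : word bool -> D) l, [/\ rel b, exists2 u, l :: u \in W & b (l :: u) = 1 &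
    tail_sum l b = \sum_(w <- W) b w * vec w - grp K (t l) * \sum_(w <- W) b w * vec w].
Proof.
have [N] := ubnP (count (fun w => a w != 0) W).
elim: N => // N IHN in a w0 *; rewrite ltnS => aN [Fa Sa] w0W a0.
pose b w := (a w0)^-1 * a w; pose l := ohd w0.
(* Modulo [span n], these are the coefficients of [t_l R - R], where [R] is the combination given by
   [b]. They vanish wherever [a] does and also at [w0]. *)
pose b1 w := twist l (ohd w) (b w) - b w.
have Fb w : frac (b w) by apply: fracM => //; apply: fracV.
have Sb : span n (\sum_(w <- W) b w * vec w).
  rewrite (eq_bigr (fun w => (a w0)^-1 * (a w * vec w))); last by move=> w _; rewrite mulrA.
  by rewrite -mulr_sumr; apply: spanM => //; apply: fracV.
have b_w0 : b w0 = 1 by rewrite /b mulVr // mn_skew.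
have [[w1 w1W b1w1]|nb1] := pselect (exists2 w, w \in W & b1 w != 0).
  apply: (IHN b1 w1) => //; last first.
    split=> [w|]; first by apply: fracB => //; apply: frac_twist.
    under eq_bigr do rewrite mulrBl.
    rewrite sumrB; apply: spanB => //.
    rewrite -[X in span n X](subrK (\sum_(w <- W) twist l (ohd w) (b w) * E (behead w))).
    by rewrite -t_combination; apply: spanD; [apply: span_t|apply: span_tails].
  apply: leq_trans aN; apply: count_lt w0W a0 _ => [w|].
    by apply: contra_neq => a_w; rewrite /b1 /b a_w mulr0 /twist mulr0 mul0r subrr.
  by rewrite negbK /b1 b_w0 /twist mulr1 mulrV ?grp_unit // subrr.
exists b, l; split; first by split.
  by exists (behead w0); have [wE _ _] := words_cons w0W; rewrite /l -wE.
have bE w : w \in W -> twist l (ohd w) (b w) = b w.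
  by move=> wW; apply/eqP; rewrite -subr_eq0; apply: contrapT => /negP ?; apply: nb1; exists w.
(* Only words beginning with [l] keep a nonzero coefficient, so [R - t_l R] consists of their
   tails. *)
have bl w : w \in W -> ohd w != l -> b w = 0.
  by move=> wW wl; apply: frac_twist_fixed wl (Fb w) (bE w wW).
rewrite t_combination opprB addrC -addrA [- _ + _]addrC /tail_sum.
rewrite -(sum_words_cons l n (fun w => b w * E (behead w))).
rewrite [X in _ = _ + X](_ : _ = 0) ?addr0; last first.
  rewrite -sumrB big_seq big1 // => w wW.
  by rewrite bE // subrr.
rewrite [RHS](bigID (fun w => ohd w == l)) /= [X in _ + X]big_seq_cond [X in _ + X]big1.
  rewrite addr0 [LHS]big_seq_cond [RHS]big_seq_cond.
  by apply: eq_bigr => w /andP[wW _]; rewrite bE.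
by move=> w /andP[wW wl]; rewrite bE // bl // mul0r.
Qed.

End MinimalRelation.

(** Let [R] be a minimal relation. For length 1, [R - t_l R = 1] contradicts
    [no_finite_ydeg_inverse]. For greater length, [R] is a combination of shorter vectors with top
    coefficients [d]; comparing coefficients at [u] in [R - t_l R = tail_sum l b] contradicts
    [no_twist_coef]. *)
Lemma vec_independent n (a : word bool -> D) : (forall w, frac (a w)) ->
  span n (\sum_(w <- words n.+1) a w * vec w) -> forall w, w \in words n.+1 -> a w = 0.
Proof.
elim: n a => [|n IH] a Fa Sa w wW; apply/eqP; apply: contrapT => /negP a0.
  have [b [l [[Fb Sb] [u luW b1]]]] := minimal_relation (conj Fa Sa) wW a0.
  have u0 : u = [::] by move: luW; rewrite mem_words => /andP[_ /eqP[/size0nil]].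
  rewrite u0 in b1; rewrite (_ : \sum_(_ <- _ | _) _ = 1); last first.
    rewrite big_mkcond (bigD1_seq [::]) ?uniq_words ?mem_words //= b1 mul1r.
    rewrite big_seq_cond big1 ?addr0 // => v /andP[].
    by rewrite mem_words => /andP[_ /eqP/size0nil ->].
  by move/esym/no_finite_ydeg_inverse; apply.
have [b [l [[Fb [d [Fd Hd]]] [u luW b1]]]] := minimal_relation (conj Fa Sa) wW a0.
set rho := \sum_(_ <- _) _ => tails.
(* Top coefficients of [R - t_l R] minus the tails; modulo shorter words, the tail [E w] counts as
   [coef (ohd w) * vec w]. *)
pose c w := d w - twist l (ohd w) (d w) - (if redb (l :: w) then b (l :: w) * coef (ohd w) else 0).
have uW : u \in words n.+1.
  move: luW; rewrite !mem_words => /andP[/path_sorted ru /eqP[->]].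
  by rewrite eqxx andbT.
have rlu : redb (l :: u) by move: luW; rewrite mem_words => /andP[].
suff c0 : c u = 0.
  apply: (@no_twist_coef l (ohd u) (- d u)).
  - have [uE _ _] := words_cons uW.
    by move: rlu; rewrite uE => /andP[].
  - exact: fracN.
  by move/eqP: c0; rewrite /c rlu b1 mul1r subr_eq0 => /eqP <-; rewrite /twist mulrN mulNr opprK addrC.
apply: (IH c) uW => [v|].
  apply: fracB; first by apply: fracB => //; apply: frac_twist.
  case: ifP => _; last exact: frac0.
  by apply: fracM => //; apply/poly_frac/poly_coef.
have -> : \sum_(v <- words n.+1) c v * vec v =
  \sum_(v <- words n.+1) d v * vec v - grp K (t l) * \sum_(v <- words n.+1) d v * vec v
  - \sum_(v <- words n.+1) twist l (ohd v) (d v) * E (behead v)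
  - \sum_(v <- words n.+1 | redb (l :: v)) b (l :: v) * (coef (ohd v) * vec v).
  rewrite t_combination opprB; set T := \sum_(v <- _) _ * E _.
  rewrite addrCA [T + _]addrC addrK [X in _ = _ - X]big_mkcond -!sumrB.
  apply: eq_bigr => v _; rewrite /c mulrBl [(d v - _) * _]mulrBl; congr (_ - _).
  by case: ifP => _; rewrite ?mul0r // mulrA.
set Sd := \sum_(v <- words n.+1) d v * vec v.
pose R := \sum_(v <- words n.+1 | redb (l :: v)) b (l :: v) * (E v - coef (ohd v) * vec v).
have -> : \sum_(v <- words n.+1 | redb (l :: v)) b (l :: v) * (coef (ohd v) * vec v) =
    \sum_(v <- words n.+1 | redb (l :: v)) b (l :: v) * E v - R.
  by rewrite -sumrB; apply: eq_bigr => v _; rewrite mulrBr opprB addrC subrK.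
set T := \sum_(v <- _) twist _ _ _ * _.
rewrite tails -[rho](subrK Sd); set tau := rho - Sd.
have cancel (X Y u1 v1 Z1 Z2 : D) :
    X - Y - Z1 - (u1 + X - (v1 + Y) - Z2) = - Z1 - (u1 - v1 - Z2).
  have -> : u1 + X - (v1 + Y) = X - Y + (u1 - v1) by rewrite opprD addrACA addrC.
  by rewrite -(addrA (X - Y) (u1 - v1)) (opprD (X - Y)) addrACA subrr add0r.
rewrite mulrDr cancel; apply: spanB; first exact/spanN/span_tails.
apply: spanB; first by apply: spanB => //; apply: span_t.
rewrite /R big_seq_cond; apply: span_sum => v /andP[/words_cons[vE rv <-] rlv].
apply: spanM => //; rewrite [in E v]vE [in vec v]vE; apply: span_ev_vec.
by rewrite -vE; apply: path_sorted rlv.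
Qed.

Lemma center_frac (z : D) : central_supp z -> frac z.
Proof. by move=> zc; apply/poly_frac/(@poly_xdeg 0) => g /zc/S_center. Qed.

(** Modulo [span n] only the longest words remain, each as [coef] times its vector, and
    [vec_independent] makes [z j * coef] vanish. If the longest word is empty, the relation has a
    single nonzero term. *)
Lemma bigraded_independent : independent K t.
Proof.
move=> N z w zc rw wd sum0 k kN; apply/eqP; apply: contrapT => /negP zk.
have [/= j zj jmax] := @arg_maxnP _ (Ordinal kN) (fun k' => z k' != 0) (fun k' => size (w k')) zk.
have others (i : 'I_N) : i != j -> w i != w j.
  move=> ij; apply/eqP; apply: wd => // ijE; move/eqP: ij; apply.
  exact: val_inj.
rewrite big_mkord in sum0; have rj : redb (w j) by apply: rw.
case wjE : (w j) => [|i u].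
  move/eqP: zj; apply; move: sum0; rewrite (bigD1 j) // big1 => [|i ij].
    by rewrite [LHS]addr0 wjE mulr1.
  have [->|zi] := eqVneq (z i) 0; first by rewrite mul0r.
  by have := jmax i zi; have := others i ij; rewrite wjE; case: (w i).
pose n := size u.
(* For [v = w j] only the index [j] occurs; the sum turns the indexed coefficients into a function
   of the word. *)
pose a v := (\sum_(k < N | w k == v) z k) * coef (ohd v).
have Fa v : frac (a v).
  apply: fracM; last exact/poly_frac/poly_coef.
  elim/big_rec: _ => [|m f _ Ff]; first exact: frac0.
  by apply: fracD => //; apply/center_frac/zc.
have wjW : w j \in words n.+1 by rewrite mem_words rj wjE eqxx.
suff : a (w j) = 0.
  rewrite /a (bigD1 j) //= big1 => [|m /andP[wm mj]].
    rewrite [_ + 0]addr0 => /(mn_mul_eq0 K_skew)[/eqP|c0]; first exact/negP.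
    by have /eqP := coef_1 (ohd (w j)); rewrite c0 mn0E eq_sym oner_eq0.
  by have := others m mj; rewrite wm.
apply: (vec_independent Fa) wjW.
have -> : \sum_(v <- words n.+1) a v * vec v =
    \sum_(k < N | size (w k) == n.+1) z k * (coef (ohd (w k)) * vec (w k)).
  under eq_bigr do rewrite /a -mulrA mulr_suml big_mkcond.
  rewrite exchange_big [RHS]big_mkcond; apply: eq_bigr => m _.
  rewrite -big_mkcond; have <- : (w m \in words n.+1) = (size (w m) == n.+1).
    by rewrite mem_words rw.
  case: ifPn => wm.
    rewrite big_mkcond (bigD1_seq _ wm) ?uniq_words //= eqxx big1 ?addr0 // => v vm.
    by rewrite eq_sym (negPf vm).
  rewrite big_seq_cond big1 // => v /andP[vW /eqP wv].
  by rewrite -wv (negPf wm) in vW.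
have small (m : 'I_N) : size (w m) != n.+1 -> span n (z m * E (w m)).
  move=> wm; have [->|zm] := eqVneq (z m) 0; first by rewrite mul0r; apply: span0.
  apply: spanM; first exact/center_frac/zc.
  apply: (@span_le (size (w m))); last exact/span_ev/rw.
  by have := jmax m zm; rewrite wjE /= leq_eqVlt (negPf wm) ltnS.
have -> : \sum_(k < N | size (w k) == n.+1) z k * (coef (ohd (w k)) * vec (w k)) =
    - \sum_(k < N | size (w k) != n.+1) z k * E (w k)
    - \sum_(k < N | size (w k) == n.+1) z k * (E (w k) - coef (ohd (w k)) * vec (w k)).
  move: sum0; rewrite (bigID (fun k : 'I_N => size (w k) == n.+1)) /=.
  move/eqP; rewrite addr_eq0 => /eqP <-; rewrite -sumrB; apply: eq_bigr => m _.
  by rewrite mulrBr opprB addrC subrK.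
apply: spanB; first by apply/spanN/span_sum => m wm; apply: small.
apply: span_sum => m /eqP wm; apply: spanM; first exact/center_frac/zc.
have rm : redb (w m) by apply: rw.
by case: (w m) wm rm => // i' u' [<-] ru; apply: span_ev_vec.
Qed.

End BigradedSeries.

(** * The two cases combined, and the theorem *)

Lemma exists_independent (G : ordgroup) (K : unitRingType) :
  (forall a : K, a != 0%R -> a \is a GRing.unit) ->
  (exists x y : G, og_mul x y <> og_mul y x) ->
  exists t : letter -> G, (forall l, t l <> 1%g) /\ independent K t.
Proof.
move=> K_skew [a [b ab]].
have [[x [y [x1 xy]]]|slow] := pselect (exists x y : G, ((1%g : G) < x)%O /\ (x ^+ 2 <= x ^ y)%O%g).
  have [|t [t1 tfree]] := @square_expanding_free G x y^-1%g x1; first by rewrite invgK.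
  exists t; split=> [l tl|]; first by move: (t1 l); rewrite tl ltxx.
  exact: free_monoid_independent.
have {}slow (x y : G) : ((1%g : G) < x)%O -> (x ^ y < x ^+ 2)%O%g.
  by move=> x1; rewrite ltNge; apply/negP => xy; apply: slow; exists x, y.
(* [c] is the commutator of the two given elements, which are exchanged if it is smaller than 1. *)
have [x [y [c [c1 yx]]]] : exists x y c : G, ((1%g : G) < c)%O /\ (y * x = c * x * y)%g.
  have [c1|] := ltP (1%g : G) (b * a * b^-1 * a^-1)%g.
    by exists a, b, (b * a * b^-1 * a^-1)%g; rewrite !mulgVK.
  rewrite le_eqVlt => /orP[/eqP c1|c1].
    case: ab; apply/esym/divg1_eq; rewrite -c1.
    by rewrite invgM mulgA.
  exists b, a, (a * b * a^-1 * b^-1)%g; rewrite !mulgVK; split=> //.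
  by move: c1; rewrite -og_lt1V !invgM !invgK !mulgA.
exists (fun l => (x ^+ digit l * y)%g).
have S1 := @bideg1 G c c1 x y.
have SM := @bidegM G slow c c1 x y.
have SV := @bidegV G slow c c1 x y.
have Su := @bideg_uniq G slow c c1 x y.
have Sx := @bideg_x G c c1 x y yx.
have Sy := @bideg_y G c c1 x y yx.
have Sc := @bideg_center G c c1 x y.
have Sk := @bideg_commute G slow c c1 x y.
have tE l : (x ^+ digit l * y)%g = (x ^+ digit l * y)%g by [].
split; first exact: (t_neq1 S1 SM Su Sx Sy tE).
exact: (bigraded_independent K_skew S1 SM SV Su Sx Sy Sc Sk tE).
Qed.

Theorem theorem3p1 (G : ordgroup) (K : unitRingType)
  (K_skew : forall a : K, a != 0%R -> a \is a GRing.unit)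
  (G_noncomm : exists x y : G, og_mul x y <> og_mul y x) :
  exists (I : Type) (x xi : I -> G -> K),
    (exists i j : I, i <> j) /\
    (forall i, in_KG (x i) /\ in_KG (xi i) /\
               feq (mn_mul (x i) (xi i)) (@mn_one G K) /\
               feq (mn_mul (xi i) (x i)) (@mn_one G K)) /\
    free_gens x xi /\
    center_lin_indep x xi.
Proof.
have [t [t1 ind]] := exists_independent K_skew G_noncomm.
exact: independent_conclusion K_skew t1 ind.
Qed.
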